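(* Let $G=\mathbb{R}^n$ be a free nilpotent Lie group (identified with $\mathbb{R}^n$ as described below) and let $\gamma:[0,1]\to G$ be a horizontal curve with $\gamma(0)=0$. The following statements are equivalent: A) The curve $\gamma$ is an abnormal extremal of corank $m\geq 1$. B) There exist $m$ linearly independent vectors $v_1,\ldots,v_m\in\mathbb{R}^n$ such that $\gamma(t)\in Z_{v_1}\cap\ldots\cap Z_{v_m}$ for all $t\in[0,1]$.
   Context: Let $\mathfrak g$ be the free nilpotent real Lie algebra of step $s\geq 2$ and rank $r\geq 2$, of dimension $n$, and let $X_1,\ldots,X_n$ be a Hall basis of $\mathfrak g$ (constructed by M. Hall's algorithm), where $X_1,\ldots,X_r$ are the generators (first layer). Each $X_\ell$ is written uniquely as $X_\ell=[\cdots[[X_{\ell_0},X_{\ell_1}],X_{\ell_2}],\dots,X_{\ell_h}]$ with $\ell_0>\ell_1$, $\ell_0,\ell_1\le r$, $\ell_1\le\ell_2\le\dots\le\ell_h$; we write $i\prec\ell$ if $X_i=[\cdots[X_{\ell_0},X_{\ell_1}],\dots,X_{\ell_k}]$ for some $k\le h$, and let $I(\ell)\in\mathbb{N}^n$ be the multi-index with $I(\ell)_j=\#\{s\geq1:\ell_s=j\}$. By Grayson–Grossman, $\mathfrak g$ is realized as a Lie algebra of vector fields on $\mathbb{R}^n$ with $X_i(x)=\sum_{\ell: i\prec\ell}\frac{(-1)^{|I(\ell)|}}{I(\ell)!}x^{I(\ell)}\partial_{x_\ell}$ for $i=1,\ldots,r$, completed to a basis $X_1,\ldots,X_n$ (a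 Hall–Grayson–Grossman basis); these are left invariant for the free nilpotent group $G$, which is identified with $\mathbb{R}^n$ via exponential coordinates of the second type $x\mapsto \exp(x_nX_n)\cdots\exp(x_1X_1)$. Here $x^\alpha=x_1^{\alpha_1}\cdots x_n^{\alpha_n}$, $|\alpha|=\alpha_1+\dots+\alpha_n$, $\alpha!=\alpha_1!\cdots\alpha_n!$ for $\alpha\in\mathbb{N}^n$. For $\alpha\in\mathbb{N}^n$, let $[X_i,X_\alpha]$ denote the iterated commutator $[\cdots[[X_i,X_1],\ldots,X_1],X_2,\ldots,X_n]$ with $X_j$ appearing $\alpha_j$ times (identity if $\alpha=0$), and define the generalized structure constants $c^k_{i\alpha}\in\mathbb{R}$ by $[X_i,X_\alpha]=\sum_{k=1}^n c^k_{i\alpha}X_k$. For $v\in\mathbb{R}^n$ and $i=1,\ldots,n$, the extremal polynomial is $P_i^v(x)=\sum_{\alpha\in\mathbb{N}^n}\frac{(-1)^{|\alpha|}}{\alpha!}\Big(\sum_{k=1}^n c^k_{i\alpha}v_k\Big)x^\alpha$, and for $v\neq0$ the abnormal variety of corank $1$ is $Z_v=\{x\in\mathbb{R}^n: P_1^v(x)=\ldots=P_r^v(x)=0\}$. A Lipschitz curve $\gamma$ is horizontal if $\dot\gamma=\sum_{j=1}^r h_jX_j(\gamma)$ a.e. for some $h\in L^\infty([0,1];\mathbb{R}^r)$. With $\mathcal E$ the end-point map $h\mapsto\gamma^h(1)$ (initial point $0$), $\gamma$ with controls $h$ is an abnormal extremal if $d\mathcal E(h)$ is not surjective, and its corank is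 $n-\dim(\mathrm{Im}\, d\mathcal E(h))\geq1$; equivalently, corank $m$ means there are $m$ linearly independent nonvanishing Lipschitz dual curves $\xi$ solving the adjoint equations $\dot\xi_k=-\sum_{j=1}^r\sum_{i=1}^n \frac{\partial X_{ji}}{\partial x_k}(\gamma)h_j\xi_i$ (where $X_j=\sum_i X_{ji}\partial_{x_i}$) with $\langle\xi,X_j(\gamma)\rangle=0$ for $j=1,\ldots,r$. *)

(* Defs.v *)
(* R : realType.  Indices are 0-based:
   the Hall basis is X_0, ..., X_(n-1); the generators are X_0, ..., X_(r-1). *)
From HB Require Import structures.
From mathcomp Require Import all_boot all_order all_algebra.
From mathcomp Require Import all_classical all_reals all_analysis.

Set Implicit Arguments.
Unset Strict Implicit.
Unset Printing Implicit Defensive.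

Import Order.TTheory GRing.Theory Num.Theory.
Import numFieldNormedType.Exports.
Local Open Scope classical_set_scope.
Local Open Scope ring_scope.

(* Hall basis (M. Hall's algorithm) of the free nilpotent Lie algebra of     *)
(* rank r and step s, of dimension n.  [hb k = None] means X_k is a          *)
(* generator; [hb k = Some (a, b)] means X_k = [X_a, X_b].  [w] is the       *)
(* weight (degree).                                                           *)

Definition hall_basis (r s n : nat) (hb : 'I_n -> option ('I_n * 'I_n))
    (w : 'I_n -> nat) : Prop :=
  [/\ (r <= n)%N /\
      (forall k : 'I_n, (k < r)%N <-> hb k = None) /\
      (forall k : 'I_n, hb k = None -> w k = 1%N),
      forall (k a b : 'I_n), hb k = Some (a, b) ->
        [/\ (b < a)%N, (a < k)%N, w k = (w a + w b)%N &
            forall a' a'' : 'I_n, hb a = Some (a', a'') -> (a'' <= b)%N],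
      (forall k : 'I_n, (w k <= s)%N) /\
      (forall k k' : 'I_n, (k <= k')%N -> (w k <= w k')%N),
      (forall k k' : 'I_n, hb k <> None -> hb k = hb k' -> k = k') &
      forall a b : 'I_n, (b < a)%N -> (w a + w b <= s)%N ->
        (forall a' a'' : 'I_n, hb a = Some (a', a'') -> (a'' <= b)%N) ->
        exists k : 'I_n, hb k = Some (a, b)].
Arguments hall_basis : clear implicits.

(* the left spine [l_0; l_1; ...; l_h] of X_l = [..[[X_l0,X_l1],X_l2],..,X_lh] *)
Fixpoint spine_f (n : nat) (hb : 'I_n -> option ('I_n * 'I_n)) (fuel : nat)
    (k : 'I_n) : seq 'I_n :=
  match fuel with
  | 0 => [:: k]
  | f.+1 => match hb k with
            | None => [:: k]
            | Some (a, b) => rcons (spine_f hb f a) b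
            end
  end.

Definition spine n hb (k : 'I_n) : seq 'I_n := spine_f hb n k.

Definition Iidx n hb (l : 'I_n) : 'I_n -> nat :=
  fun j => count (pred1 j) (behead (spine hb l)).

Definition VF (R : realType) (n : nat) := 'rV[R]_n -> 'rV[R]_n.

Definition xpow (R : realType) n (x : 'rV[R]_n) (al : 'I_n -> nat) : R :=
  \prod_(j < n) x ord0 j ^+ al j.
Definition mabs n (al : 'I_n -> nat) : nat := (\sum_(j < n) al j)%N.
Definition mfact n (al : 'I_n -> nat) : nat := (\prod_(j < n) (al j)`!)%N.

(* Lie bracket of vector fields: [X,Y] = DY.X - DX.Y  (so [X,Y]f = X(Yf)-Y(Xf)) *)
Definition lie (R : realType) n (X Y : VF R n) : VF R n :=
  fun x => 'D_(X x) Y x - 'D_(Y x) X x.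

(* Grayson--Grossman generator fields:
   X_i(x) = sum_{l : i < l} (-1)^|I(l)| / I(l)! x^I(l) d/dx_l,
   where (for a generator i) i < l means l_0 = i. *)
Definition gg_gen (R : realType) n hb (i : 'I_n) : VF R n :=
  fun x => \row_(l < n)
    (if head l (spine hb l) == i then
       (-1) ^+ mabs (Iidx hb l) / (mfact (Iidx hb l))%:R * xpow x (Iidx hb l)
     else 0).
Arguments gg_gen R {n} hb i x.

Fixpoint hgg_f (R : realType) n hb (fuel : nat) (k : 'I_n) : VF R n :=
  match fuel with
  | 0 => gg_gen R hb k
  | f.+1 => match hb k with
            | None => gg_gen R hb k
            | Some (a, b) => lie (@hgg_f R _ hb f a) (@hgg_f R _ hb f b)
            end
  end.
Arguments hgg_f R {n} hb fuel k x.

Definition HGG (R : realType) n hb (k : 'I_n) : VF R n := hgg_f R hb n k.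
Arguments HGG R {n} hb k x.

Definition itbr (R : realType) n hb (i : 'I_n) (al : {ffun 'I_n -> nat}) : VF R n :=
  foldl (fun Z j => lie Z (HGG R hb j)) (HGG R hb i)
        (flatten [seq nseq (al j) j | j <- enum 'I_n]).
Arguments itbr R {n} hb i al x.

Definition gsc (R : realType) n hb (i : 'I_n) (al : {ffun 'I_n -> nat}) : 'rV[R]_n :=
  xget 0 [set c : 'rV[R]_n |
           itbr R hb i al = (fun x => \sum_(k < n) c ord0 k *: HGG R hb k x)].
Arguments gsc R {n} hb i al.

(* extremal polynomial P_i^v (a finitely supported sum over alpha in N^n) *)
Definition Pext (R : realType) n hb (i : 'I_n) (v x : 'rV[R]_n) : R :=
  \sum_(al \in [set: {ffun 'I_n -> nat}])
     ((-1) ^+ mabs al / (mfact al)%:R *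
      (\sum_(k < n) gsc R hb i al ord0 k * v ord0 k) * xpow x al).
Arguments Pext R {n} hb i v x.

Definition Zvar (R : realType) (r : nat) n hb (v : 'rV[R]_n) : set 'rV[R]_n :=
  [set x | forall i : 'I_n, (i < r)%N -> Pext R hb i v x = 0].

Definition I01 (R : realType) : set R := [set t | 0 <= t <= 1].
Arguments I01 : clear implicits.

Definition lipschitz01 (R : realType) n (g : R -> 'rV[R]_n) : Prop :=
  exists L : R, forall s t, I01 R s -> I01 R t -> `|g s - g t| <= L * `|s - t|.

(* gamma Lipschitz, h in L^oo([0,1]; R^r) (components h_j, j < r; the other
   components are unused), and gamma' = sum_{j<r} h_j X_j(gamma) a.e. *)
Definition horizontal (R : realType) (r : nat) n hb (g : R -> 'rV[R]_n)
    (h : 'I_n -> R -> R) : Prop :=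
  [/\ lipschitz01 g,
      forall j : 'I_n, (j < r)%N ->
        measurable_fun (I01 R) (h j) /\
        exists M : R, {ae lebesgue_measure, forall t, I01 R t -> `|h j t| <= M} &
      {ae lebesgue_measure, forall t, I01 R t ->
         derivable g t 1 /\
         derive1 g t = \sum_(j < n | (j < r)%N) h j t *: HGG R hb j (g t)}].

Definition dual_curve (R : realType) (r : nat) n hb (g : R -> 'rV[R]_n)
    (h : 'I_n -> R -> R) (xi : R -> 'rV[R]_n) : Prop :=
  [/\ lipschitz01 xi,
      forall t, I01 R t -> xi t != 0,
      {ae lebesgue_measure, forall t, I01 R t ->
         derivable xi t 1 /\
         forall k : 'I_n, derive1 xi t ord0 k =
           - \sum_(j < n | (j < r)%N) \sum_(i < n)
               ('D_(delta_mx ord0 k) (HGG R hb j) (g t)) ord0 i * h j t * xi t ord0 i} &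
      forall t, I01 R t -> forall j : 'I_n, (j < r)%N ->
        \sum_(i < n) xi t ord0 i * HGG R hb j (g t) ord0 i = 0].

(* gamma (with controls h) is an abnormal extremal of corank (at least) m:
   there are m linearly independent dual curves *)
Definition abnormal_corank (R : realType) (r : nat) n hb (g : R -> 'rV[R]_n)
    (h : 'I_n -> R -> R) (m : nat) : Prop :=
  exists xis : 'I_m -> R -> 'rV[R]_n,
    (forall l, dual_curve r hb g h (xis l)) /\
    (forall lam : 'I_m -> R,
       (forall t, I01 R t -> \sum_(l < m) lam l *: xis l t = 0) ->
       forall l, lam l = 0).

(* Main.v *)
(* Write E(x) = exp(x_1 ad X_1) ... exp(x_n ad X_n), where row k of the matrix ad X_j
   holds the coordinates of [X_j, X_k] in the Hall basis; expanding the exponentials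
   gives P_i^v(x) = (E(x) v)_i.  The Hall fields are homogeneous and X_k = d_k where
   x_1 = ... = x_(k-1) = 0, and by M. Hall's rewriting their span is closed under
   brackets; a downward induction on k, along the lines parallel to the k-th axis, then
   gives X_j E = (ad X_j) E everywhere.

   Along the horizontal curve, the numbers <xi, X_k> of a dual curve xi and the values of
   P_k^v with v = xi(0) therefore satisfy the same linear system.  Since ad X_j raises the
   weight, that system is triangular, and uniqueness reduces to the fact that a Lipschitz
   function with a.e. zero derivative is constant.  Hence P_k^v(gamma) = <xi, X_k(gamma)>,
   which proves A => B.  Conversely v defines a right-invariant 1-form, and its restriction
   to the curve is the dual curve. *)

(* Weighted homogeneity turns nilpotency into degree counting, since a bracket heavier than [s] has
   coefficients of negative degree. The subspaces H_k, on which the coordinates of index below k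
   vanish, supply explicit values: there the factors of E before the k-th are trivial. The obstacle
   is that E is an ordered product of noncommuting factors, so that d_k E = (ad X_k) E can be read
   off on H_k only. The defect X_j E - (ad X_j) E carries the identity further: along the k-th axis
   inside H_k it obeys a linear system whose inhomogeneous part cancels by the Jacobi identity. The
   signs (-1)^|alpha| of P_i^v cancel those produced by bracketing on the right, which is why E
   consists of plain exponentials. *)
Require Import Defs.
From HB Require Import structures.
From mathcomp Require Import all_boot all_order all_algebra.
From mathcomp Require Import all_classical all_reals all_analysis.
From mathcomp Require Import measurable_realfun.
From mathcomp Require Import ring lra zify.
Set Implicit Arguments.
Unset Strict Implicit.
Unset Printing Implicit Defensive.
Import Order.TTheory GRing.Theory Num.Theory.
Import numFieldNormedType.Exports.
Local Open Scope classical_set_scope.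
Local Open Scope ring_scope.

(* Locked so that unification never unfolds the limit behind 'D. *)
HB.lock Definition pd (R : realType) n (k : 'I_n) (f : 'rV[R]_n -> R) :
  'rV[R]_n -> R := fun x => 'D_(delta_mx ord0 k) f x.

(** * Polynomial functions and their partial derivatives *)

Section PolynomialFunctions.
Variables (R : realType) (n : nat).
Implicit Types (f g : 'rV[R]_n -> R) (x v : 'rV[R]_n) (j k : 'I_n) (c : R).

(** Polynomials are kept as functions with an inductive certificate, so that differentiability and
    the calculus rules follow by structural induction, without passing through formal
    polynomials. *)
Inductive polyf : ('rV[R]_n -> R) -> Prop :=
| polyf_cst c : polyf (fun=> c)
| polyf_coord i : polyf (fun x => x ord0 i)
| polyf_add f g : polyf f -> polyf g -> polyf (fun x => f x + g x)
| polyf_mul f g : polyf f -> polyf g -> polyf (fun x => f x * g x).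

Lemma polyf_differentiable f x : polyf f -> differentiable f x.
Proof.
elim=> [c|i|{}f g _ df _ dg|{}f g _ df _ dg].
- exact: differentiable_cst.
- exact: differentiable_coord.
- exact: differentiableD.
- exact: differentiableM.
Qed.

Lemma polyf_derivable f x v : polyf f -> derivable f x v.
Proof. by move=> /(polyf_differentiable x)/diff_derivable. Qed.

Lemma derive_pd f x v : polyf f -> 'D_v f x = \sum_k v ord0 k * pd k f x.
Proof.
move=> /(polyf_differentiable x) df; rewrite deriveE// {1}(row_sum_delta v).
rewrite linear_sum; apply: eq_bigr => k _.
by rewrite linearZ pd.unlock deriveE.
Qed.

Lemma pd_cst k c : pd k (fun=> c) = (fun=> 0).
Proof. by apply/funext => x; rewrite pd.unlock derive_cst. Qed.

Lemma pd_coord k (i : 'I_n) : pd k (fun x => x ord0 i) = (fun=> (k == i)%:R).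
Proof.
apply/funext => x; rewrite pd.unlock /derive.
have -> : (fun h : R => h^-1 *: ((h *: delta_mx ord0 k + x : 'rV_n) ord0 i - x ord0 i)) =
   (fun h : R => h^-1 * h * (k == i)%:R).
  apply/funext => h; rewrite !mxE eqxx /= addrK eq_sym.
  by rewrite -[_ *: _]/(_ * _) mulrA.
apply: cvg_lim => //; apply: cvg_near_cst.
near=> h; rewrite mulVf ?mul1r//.
by near: h; exact: nbhs_dnbhs_neq.
Unshelve. all: by end_near. Qed.

Lemma pd_add k f g : polyf f -> polyf g ->
  pd k (fun x => f x + g x) = (fun x => pd k f x + pd k g x).
Proof.
by move=> pf pg; apply/funext => x; rewrite pd.unlock deriveD//; exact: polyf_derivable.
Qed.

Lemma pd_mul k f g : polyf f -> polyf g ->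
  pd k (fun x => f x * g x) = (fun x => pd k f x * g x + f x * pd k g x).
Proof.
move=> pf pg; apply/funext => x; rewrite pd.unlock deriveM; try exact: polyf_derivable.
by rewrite addrC -!/(_ * _) -[g x *: _]/(_ * _) mulrC.
Qed.

Lemma polyf_pd k f : polyf f -> polyf (pd k f).
Proof.
elim=> [c|i|{}f g pf IHf pg IHg|{}f g pf IHf pg IHg].
- by rewrite pd_cst; exact: polyf_cst.
- by rewrite pd_coord; exact: polyf_cst.
- by rewrite pd_add//; exact: polyf_add.
- by rewrite pd_mul//; apply: polyf_add; apply: polyf_mul.
Qed.

(** For polynomials the symmetry of second derivatives is algebraic: it passes to products by
    applying the Leibniz rule twice. *)
Lemma pdC j k f : polyf f -> pd j (pd k f) = pd k (pd j f).
Proof.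
elim=> [c|i|{}f g pf IHf pg IHg|{}f g pf IHf pg IHg].
- by rewrite (pd_cst k c) (pd_cst j c) (pd_cst k 0) (pd_cst j 0).
- by rewrite (pd_coord k i) (pd_coord j i) (pd_cst j) (pd_cst k).
- have [pfk pfj] := (polyf_pd k pf, polyf_pd j pf).
  have [pgk pgj] := (polyf_pd k pg, polyf_pd j pg).
  by rewrite (pd_add k pf pg) (pd_add j pf pg) (pd_add j pfk pgk) (pd_add k pfj pgj) IHf IHg.
- have [pfk pfj] := (polyf_pd k pf, polyf_pd j pf).
  have [pgk pgj] := (polyf_pd k pg, polyf_pd j pg).
  rewrite (pd_mul k pf pg) (pd_mul j pf pg).
  rewrite (pd_add j (polyf_mul pfk pg) (polyf_mul pf pgk)).
  rewrite (pd_add k (polyf_mul pfj pg) (polyf_mul pf pgj)).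
  rewrite (pd_mul j pfk pg) (pd_mul j pf pgk) (pd_mul k pfj pg) (pd_mul k pf pgj).
  by rewrite IHf IHg; apply/funext => x; ring.
Qed.

Lemma polyf_opp f : polyf f -> polyf (fun x => - f x).
Proof.
move=> pf; have := polyf_mul (polyf_cst (-1)) pf.
by congr polyf; apply/funext => x; rewrite mulN1r.
Qed.

Lemma polyf_sub f g : polyf f -> polyf g -> polyf (fun x => f x - g x).
Proof. by move=> pf pg; apply: polyf_add => //; exact: polyf_opp. Qed.

Lemma polyf_sum I (s : seq I) (P : pred I) (F : I -> 'rV[R]_n -> R) :
  (forall i, polyf (F i)) -> polyf (fun x => \sum_(i <- s | P i) F i x).
Proof.
move=> pF; elim: s => [|i s IHs].
  by under eq_fun do rewrite big_nil; exact: polyf_cst.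
under eq_fun do rewrite big_cons.
by case: (P i) => //; exact: polyf_add.
Qed.

Lemma polyf_prod I (s : seq I) (P : pred I) (F : I -> 'rV[R]_n -> R) :
  (forall i, polyf (F i)) -> polyf (fun x => \prod_(i <- s | P i) F i x).
Proof.
move=> pF; elim: s => [|i s IHs].
  by under eq_fun do rewrite big_nil; exact: polyf_cst.
under eq_fun do rewrite big_cons.
by case: (P i) => //; exact: polyf_mul.
Qed.

Lemma polyf_exp f m : polyf f -> polyf (fun x => f x ^+ m).
Proof.
move=> pf; elim: m => [|m IHm].
  by under eq_fun do rewrite expr0; exact: polyf_cst.
by under eq_fun do rewrite exprS; exact: polyf_mul.
Qed.

Lemma pd_opp k f : polyf f -> pd k (fun x => - f x) = (fun x => - pd k f x).
Proof.
move=> pf; have := pd_mul k (polyf_cst (-1)) pf.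
under eq_fun do rewrite mulN1r.
by move=> ->; apply/funext => x; rewrite pd_cst mul0r add0r mulN1r.
Qed.

Lemma pd_sum k I (s : seq I) (P : pred I) (F : I -> 'rV[R]_n -> R) :
  (forall i, polyf (F i)) ->
  pd k (fun x => \sum_(i <- s | P i) F i x) =
  (fun x => \sum_(i <- s | P i) pd k (F i) x).
Proof.
move=> pF; elim: s => [|i s IHs].
  under eq_fun do rewrite big_nil.
  by rewrite pd_cst; apply/funext => x; rewrite big_nil.
under eq_fun do rewrite big_cons.
case Pi: (P i).
  rewrite pd_add// ?IHs; last exact: polyf_sum.
  by apply/funext => x; rewrite big_cons Pi.
by rewrite IHs; apply/funext => x; rewrite big_cons Pi.
Qed.

Lemma derive_line f x (k : 'I_n) (t : R) : polyf f ->
  is_derive t 1 (fun s => f (x + s *: delta_mx ord0 k))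
    (pd k f (x + t *: delta_mx ord0 k)).
Proof.
move=> pf.
have key : (fun h : R => h^-1 *: (((fun s => f (x + s *: delta_mx ord0 k)) \o shift t) (h *: 1) -
     f (x + t *: delta_mx ord0 k))) =
  (fun h : R => h^-1 *: ((f \o shift (x + t *: delta_mx ord0 k)) (h *: delta_mx ord0 k) -
     f (x + t *: delta_mx ord0 k))).
  apply/funext => h /=; congr (_ *: (f _ - _)).
  by rewrite -[h *: 1]/(h * 1) mulr1 scalerDl addrCA.
rewrite pd.unlock; have d := @polyf_derivable _ (x + t *: delta_mx ord0 k) (delta_mx ord0 k) pf.
split; first by rewrite /derivable key.
by rewrite /derive key.
Qed.

(** This is the only integration in space: it moves a point along the [k]-th axis to where its
    [k]-th coordinate vanishes. *)
Lemma line_cst f x (k : 'I_n) (t : R) : polyf f ->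
  (forall s, pd k f (x + s *: delta_mx ord0 k) = 0) ->
  f (x + t *: delta_mx ord0 k) = f x.
Proof.
move=> pf f0.
have -> : f x = f (x + 0 *: delta_mx ord0 k) by rewrite scale0r addr0.
apply: (@is_derive_0_is_cst _ (fun s => f (x + s *: delta_mx ord0 k))) => s.
by rewrite -(f0 s); exact: derive_line.
Qed.

End PolynomialFunctions.

(** * Weighted homogeneity *)

Section Homogeneous.
Variables (R : realType) (n : nat) (w : 'I_n -> nat).
Implicit Types (f g : 'rV[R]_n -> R) (d e : int) (j k : 'I_n) (c : R).

(** Degrees are integers because [pd k] lowers them by [w k], possibly below zero; the zero function
    therefore has every degree. *)
Inductive homf : int -> ('rV[R]_n -> R) -> Prop :=
| homf_zero d : homf d (fun=> 0)
| homf_cst c : homf 0 (fun=> c)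
| homf_coord i : homf (w i)%:Z (fun x => x ord0 i)
| homf_add d f g : homf d f -> homf d g -> homf d (fun x => f x + g x)
| homf_mul d e f g : homf d f -> homf e g -> homf (d + e) (fun x => f x * g x).

Lemma homf_polyf d f : homf d f -> polyf f.
Proof. by elim=> *; constructor. Qed.

Lemma homf_pd k d f : homf d f -> homf (d - (w k)%:Z) (pd k f).
Proof.
elim=> [{}d|c|i|{}d {}f g hf IHf hg IHg|{}d e {}f g hf IHf hg IHg].
- by rewrite pd_cst; exact: homf_zero.
- by rewrite pd_cst; exact: homf_zero.
- rewrite pd_coord; case: eqVneq => [->|_] /=; last exact: homf_zero.
  by rewrite subrr; exact: homf_cst.
- rewrite pd_add; [exact: homf_add|exact: homf_polyf hf|exact: homf_polyf hg].
- rewrite pd_mul; [|exact: homf_polyf hf|exact: homf_polyf hg].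
  apply: homf_add; first by rewrite addrAC; exact: homf_mul.
  by rewrite -addrA; exact: homf_mul.
Qed.

Hypothesis w_gt0 : forall k, (0 < w k)%N.

(** The zero function is set apart because its degree may be negative. Nonzero factors have
    nonnegative degrees, so a product of degree 0 has both factors of degree 0, hence constant. *)
Lemma homf_low d f : homf d f ->
  f = (fun=> 0) \/ 0 <= d /\ (d = 0 -> f = fun=> f 0).
Proof.
elim=> [{}d|c|i|{}d {}f g _ IHf _ IHg|{}d e {}f g _ IHf _ IHg].
- by left.
- by right.
- by right; split=> // wi; have := w_gt0 i; lia.
- case: IHf => [->|[d0 cf]]; case: IHg => [->|[d0' cg]].
  + by left; apply/funext => x; rewrite addr0.
  + by right; split=> // /cg ->.
  + by right; split=> // /cf ->.
  + by right; split=> // dE; apply/funext => x; rewrite cf// cg.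
- case: IHf => [->|[d0 cf]]; first by left; apply/funext => x; rewrite mul0r.
  case: IHg => [->|[e0 cg]]; first by left; apply/funext => x; rewrite mulr0.
  right; split=> [|de]; first exact: addr_ge0.
  have [dE eE] : d = 0 /\ e = 0 by lia.
  by apply/funext => x; rewrite cf// cg.
Qed.

Lemma homf_lt0 d f : homf d f -> d < 0 -> f = fun=> 0.
Proof. by move=> /homf_low[//|[d0 _]]; rewrite ltNge d0. Qed.

Lemma homf_eq0 f : homf 0 f -> f = fun=> f 0.
Proof. by move=> /homf_low[->//|[_]]; apply. Qed.

Lemma homf_sum I (s : seq I) (P : pred I) (F : I -> 'rV[R]_n -> R) d :
  (forall i, P i -> homf d (F i)) -> homf d (fun x => \sum_(i <- s | P i) F i x).
Proof.
move=> pF; elim: s => [|i s IHs].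
  by under eq_fun do rewrite big_nil; exact: homf_zero.
under eq_fun do rewrite big_cons.
case Pi: (P i) => //; apply: homf_add => //; exact: pF.
Qed.

Lemma homf_xpow (al : 'I_n -> nat) :
  homf (\sum_j al j * w j)%N%:Z (fun x => xpow x al).
Proof.
rewrite /xpow; elim: (index_enum _) => [|i s IHs].
  by rewrite big_nil; under eq_fun do rewrite big_nil; exact: homf_cst.
rewrite big_cons [X in homf _ X](_ : _ = (fun x : 'rV[R]_n =>
    x ord0 i ^+ al i * \prod_(j <- s) x ord0 j ^+ al j)); last first.
  by apply/funext => x; rewrite big_cons.
rewrite PoszD; apply: homf_mul => //.
elim: (al i) => [|m IHm]; first by under eq_fun do rewrite expr0; exact: homf_cst.
under eq_fun do rewrite exprS.
by rewrite mulSn PoszD; apply: homf_mul => //; exact: homf_coord.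
Qed.

End Homogeneous.

(** * Polynomial vector fields, their brackets and the Jacobi identity *)

HB.lock Definition brk (R : realType) n (X Y : VF R n) : VF R n := lie X Y.

Section VectorFields.
Variables (R : realType) (n : nat).
Implicit Types (f g : 'rV[R]_n -> R) (X Y Z : VF R n) (x v : 'rV[R]_n).

Definition polyvf X := forall i, polyf (fun x => X x ord0 i).

Definition lder X f : 'rV[R]_n -> R := fun x => \sum_k X x ord0 k * pd k f x.

Lemma polyf_lder X f : polyvf X -> polyf f -> polyf (lder X f).
Proof.
move=> pX pf; apply: polyf_sum => k; apply: polyf_mul; first exact: pX.
exact: polyf_pd.
Qed.

Lemma derive_vf Y x v i : polyvf Y ->
  ('D_v Y x) ord0 i = \sum_k v ord0 k * pd k (fun x => Y x ord0 i) x.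
Proof.
move=> pY; rewrite derive_mx; last first.
  by apply/derivable_mxP => a b; rewrite ord1; exact: polyf_derivable.
by rewrite mxE derive_pd.
Qed.

Lemma derive_delta Y x k i : polyvf Y ->
  ('D_(delta_mx ord0 k) Y x) ord0 i = pd k (fun y => Y y ord0 i) x.
Proof.
move=> pY; rewrite derive_vf// (bigD1 k)//= mxE !eqxx mul1r big1 ?addr0// => j jk.
by rewrite mxE (negbTE jk) andbF mul0r.
Qed.

Lemma brkE X Y x i : polyvf X -> polyvf Y ->
  brk X Y x ord0 i =
  lder X (fun x => Y x ord0 i) x - lder Y (fun x => X x ord0 i) x.
Proof. by move=> pX pY; rewrite brk.unlock /lie !mxE !derive_vf. Qed.

Lemma brkN X Y : brk X Y = (fun x => - brk Y X x).
Proof. by apply/funext => x; rewrite brk.unlock /lie opprB. Qed.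

Lemma brkE_fun X Y i : polyvf X -> polyvf Y ->
  (fun x => brk X Y x ord0 i) =
  (fun x => lder X (fun x => Y x ord0 i) x - lder Y (fun x => X x ord0 i) x).
Proof. by move=> pX pY; apply/funext => x; exact: brkE. Qed.

Lemma polyvf_brk X Y : polyvf X -> polyvf Y -> polyvf (brk X Y).
Proof.
move=> pX pY i; rewrite brkE_fun//.
by apply: polyf_sub; exact: polyf_lder.
Qed.

Lemma lder_sub X f g : polyf f -> polyf g ->
  lder X (fun x => f x - g x) = (fun x => lder X f x - lder X g x).
Proof.
move=> pf pg; apply/funext => x; rewrite /lder -sumrB; apply: eq_bigr => k _.
by rewrite pd_add ?pd_opp//; [rewrite mulrDr mulrN|exact: polyf_opp].
Qed.

Lemma lder_brk X Y f : polyvf X -> polyvf Y -> polyf f ->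
  lder (brk X Y) f = (fun x => lder X (lder Y f) x - lder Y (lder X f) x).
Proof.
move=> pX pY pf.
(* The composite derivation splits into a first-order part and a second-order part; the latter is
   symmetric in the two fields by [pdC] and drops out of the commutator. *)
have expand X' Y' x : polyvf Y' -> lder X' (lder Y' f) x =
    lder (fun y => \row_k lder X' (fun z => Y' z ord0 k) y) f x +
    \sum_k \sum_l X' x ord0 k * (Y' x ord0 l * pd k (pd l f) x).
  move=> pY'; rewrite /lder.
  under eq_bigr => k _.
    rewrite pd_sum; last by move=> l; apply: polyf_mul; [exact: pY'|exact: polyf_pd].
    rewrite big_distrr /=.
    under eq_bigr => l _ do rewrite (pd_mul k (pY' l) (polyf_pd l pf)) mulrDr.
    rewrite big_split /=; over.
  rewrite big_split /= exchange_big /=; congr (_ + _).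
  apply: eq_bigr => l _; rewrite mxE big_distrl /=; apply: eq_bigr => k _.
  by rewrite mulrA.
apply/funext => x; rewrite !expand// [X in _ = _ + X - _]exchange_big /=.
have -> : \sum_j \sum_i X x ord0 i * (Y x ord0 j * pd i (pd j f) x) =
    \sum_k \sum_l Y x ord0 k * (X x ord0 l * pd k (pd l f) x).
  by apply: eq_bigr => k _; apply: eq_bigr => l _; rewrite pdC// mulrCA.
rewrite opprD addrACA subrr addr0 /lder -sumrB; apply: eq_bigr => k _.
by rewrite brkE// !mxE mulrBl.
Qed.

(** Stated as a derivation rule for the bracket with [Z], the form used by Hall's rewriting. On
    components, both sides reduce to the same signed sum of twofold derivatives, because brackets
    act as commutators of derivations. *)
Lemma jacobi X Y Z : polyvf X -> polyvf Y -> polyvf Z ->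
  brk (brk X Y) Z = (fun x => brk (brk X Z) Y x - brk (brk Y Z) X x).
Proof.
move=> pX pY pZ; apply/funext => x; apply/rowP => i.
rewrite [RHS]mxE [X in _ = _ + X]mxE.
have [pXY pXZ pYZ] := And3 (polyvf_brk pX pY) (polyvf_brk pX pZ) (polyvf_brk pY pZ).
rewrite (brkE _ _ pXY pZ) (brkE _ _ pXZ pY) (brkE _ _ pYZ pX).
rewrite (lder_brk pX pY (pZ i)) (lder_brk pX pZ (pY i)) (lder_brk pY pZ (pX i)).
rewrite (brkE_fun i pX pY) (brkE_fun i pX pZ) (brkE_fun i pY pZ).
have pl A B : polyvf A -> polyvf B -> polyf (lder A (fun x => B x ord0 i)).
  by move=> pA pB; exact: polyf_lder.
rewrite (lder_sub Z (pl _ _ pX pY) (pl _ _ pY pX)).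
rewrite (lder_sub Y (pl _ _ pX pZ) (pl _ _ pZ pX)).
rewrite (lder_sub X (pl _ _ pY pZ) (pl _ _ pZ pY)).
by ring.
Qed.

Lemma polyvf_comb I (s : seq I) (c : I -> R) (X : I -> VF R n) :
  (forall k, polyvf (X k)) -> polyvf (fun x => \sum_(k <- s) c k *: X k x).
Proof.
move=> pX i; under eq_fun => x.
  rewrite summxE; under eq_bigr do rewrite mxE.
  over.
by apply: polyf_sum => k; apply: polyf_mul; [exact: polyf_cst|exact: pX].
Qed.

Lemma brk_combl I (s : seq I) (c : I -> R) (X : I -> VF R n) Y :
  (forall k, polyvf (X k)) -> polyvf Y ->
  brk (fun x => \sum_(k <- s) c k *: X k x) Y =
  (fun x => \sum_(k <- s) c k *: brk (X k) Y x).
Proof.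
move=> pX pY; apply/funext => x; apply/rowP => i.
rewrite brkE//; last exact: polyvf_comb.
rewrite summxE; under [RHS]eq_bigr do rewrite mxE brkE// mulrBr.
rewrite sumrB; congr (_ - _).
  rewrite /lder; under eq_bigr do rewrite summxE big_distrl /=.
  rewrite exchange_big /=; apply: eq_bigr => a _; rewrite big_distrr /=.
  by apply: eq_bigr => k _; rewrite mxE mulrA.
rewrite [in LHS](_ : (fun x : 'rV[R]_n => (\sum_(k <- s) c k *: X k x) ord0 i) =
    (fun x => \sum_(k <- s) c k * X k x ord0 i)); last first.
  by apply/funext => y; rewrite summxE; apply: eq_bigr => k _; rewrite mxE.
rewrite /lder; under eq_bigr => k _.
  rewrite pd_sum; last by move=> a; apply: polyf_mul; [exact: polyf_cst|exact: pX].
  rewrite big_distrr /=.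
  under eq_bigr => a _ do rewrite (pd_mul k (polyf_cst _ (c a)) (pX a i)) pd_cst mul0r add0r.
  over.
rewrite exchange_big /=; apply: eq_bigr => a _; rewrite big_distrr /=.
by apply: eq_bigr => k _; rewrite mulrCA.
Qed.

Lemma brk_combr I (s : seq I) (c : I -> R) (X : I -> VF R n) Y :
  (forall k, polyvf (X k)) -> polyvf Y ->
  brk Y (fun x => \sum_(k <- s) c k *: X k x) =
  (fun x => \sum_(k <- s) c k *: brk Y (X k) x).
Proof.
move=> pX pY; rewrite brkN brk_combl//; apply/funext => x.
by rewrite -sumrN; apply: eq_bigr => k _; rewrite [brk Y _]brkN scalerN.
Qed.

(** Since d_i has degree -[w i], this says that the field as an operator lowers degrees by [e]. *)
Definition homvf (w : 'I_n -> nat) (e : nat) X :=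
  forall i, homf w ((w i)%:Z - e%:Z) (fun x => X x ord0 i).

Lemma homvf_polyvf w e X : homvf w e X -> polyvf X.
Proof. by move=> hX i; exact: homf_polyf (hX i). Qed.

Lemma homvf_brk w d e X Y : homvf w d X -> homvf w e Y -> homvf w (d + e) (brk X Y).
Proof.
move=> hX hY i; rewrite brkE_fun; [|exact: homvf_polyvf hX|exact: homvf_polyvf hY].
have h (a b : nat) X' Y' : homvf w a X' -> homvf w b Y' ->
    homf w ((w i)%:Z - (a + b)%N%:Z) (lder X' (fun x => Y' x ord0 i)).
  move=> hX' hY'; apply: homf_sum => k _.
  rewrite (_ : _ - _ = (w k)%:Z - a%:Z + ((w i)%:Z - b%:Z - (w k)%:Z)); last by lia.
  by apply: homf_mul; [exact: hX'|apply: homf_pd; exact: hY'].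
have hYX := homf_mul (homf_cst w (-1)) (h _ _ _ _ hY hX).
rewrite add0r addnC in hYX.
have := homf_add (h _ _ _ _ hX hY) hYX; congr homf.
by apply/funext => x; rewrite mulN1r.
Qed.

End VectorFields.

(** * Combinatorics of the Hall basis: spines and their letters *)

Section HallCombinatorics.
Variables (r s n : nat) (hb : 'I_n -> option ('I_n * 'I_n)) (w : 'I_n -> nat).
Hypothesis Hhall : hall_basis r s n hb w.
Implicit Types i j k l a b : 'I_n.

Lemma hb_lt k a b : hb k = Some (a, b) -> (b < a)%N /\ (a < k)%N.
Proof. by case: Hhall => _ + _ _ _ kab => /(_ _ _ _ kab)[]. Qed.

Lemma hb_w k a b : hb k = Some (a, b) -> w k = (w a + w b)%N.
Proof. by case: Hhall => _ + _ _ _ kab => /(_ _ _ _ kab)[]. Qed.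

Lemma hb_le k a b a' a'' : hb k = Some (a, b) -> hb a = Some (a', a'') -> (a'' <= b)%N.
Proof. by case: Hhall => _ + _ _ _ kab => /(_ _ _ _ kab)[_ _ _]; apply. Qed.

Lemma w_gen k : hb k = None -> w k = 1%N.
Proof. by case: Hhall => -[_ [_ +]] _ _ _ _; apply. Qed.

Lemma w_les k : (w k <= s)%N.
Proof. by case: Hhall => _ _ [+ _] _ _; apply. Qed.

Lemma w_mono j k : (j <= k)%N -> (w j <= w k)%N.
Proof. by case: Hhall => _ _ [_ +] _ _; apply. Qed.

Lemma w_lt j k : (w j < w k)%N -> (j < k)%N.
Proof. by move=> jk; rewrite ltnNge; apply/negP => /w_mono; rewrite leqNgt jk. Qed.

Lemma hb_inj j k a b : hb j = Some (a, b) -> hb k = Some (a, b) -> j = k.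
Proof. by case: Hhall => _ _ _ + _ jab kab; apply; rewrite jab. Qed.

Lemma hb_ex a b : (b < a)%N -> (w a + w b <= s)%N ->
  (forall a' a'', hb a = Some (a', a'') -> (a'' <= b)%N) ->
  exists k, hb k = Some (a, b).
Proof. by case: Hhall => _ _ _ _; apply. Qed.

Lemma ord_ind_lt (P : 'I_n -> Prop) :
  (forall k, (forall j, (j < k)%N -> P j) -> P k) -> forall k, P k.
Proof.
move=> IH k; have [m] := ubnP (val k); elim: m k => // m IHm k km.
by apply: IH => j jk; apply: IHm; rewrite /= in km *; lia.
Qed.

(** Induction on bracket trees, well founded because both factors of a bracket have smaller
    indices. *)
Lemma hall_ind (P : 'I_n -> Prop) :
  (forall k, hb k = None -> P k) ->
  (forall k a b, hb k = Some (a, b) -> P a -> P b -> P k) ->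
  forall k, P k.
Proof.
move=> Pgen Pbr; apply: ord_ind_lt => k IH.
case kE : (hb k) => [[a b]|]; last exact: Pgen.
have [ba ak] := hb_lt kE.
by apply: (Pbr _ _ _ kE); apply: IH => //; exact: ltn_trans ak.
Qed.

Lemma w_gt0 k : (0 < w k)%N.
Proof.
elim/hall_ind: k => [k /w_gen -> //|k a b /hb_w -> a0 _].
by rewrite addn_gt0 a0.
Qed.

(** Indices strictly decrease along left factors, so any fuel above the index suffices; in
    particular [n] does. *)
Lemma spine_f_fuel f f' k : (k < f)%N -> (k < f')%N ->
  spine_f hb f k = spine_f hb f' k.
Proof.
elim: f f' k => // f IH [//|f'] k kf kf' /=.
case kE : (hb k) => [[a b]|//]; have [_ ak] := hb_lt kE.
by congr rcons; apply: IH; exact: leq_trans ak _.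
Qed.

Lemma spineE k :
  spine hb k = if hb k is Some (a, b) then rcons (spine hb a) b else [:: k].
Proof.
suff H f : (k < f)%N -> spine_f hb f k =
    if hb k is Some (a, b) then rcons (spine hb a) b else [:: k] by exact: H.
case: f => //= f kf; case kE : (hb k) => [[a b]|//]; have [_ ak] := hb_lt kE.
by congr rcons; apply: spine_f_fuel => //; exact: leq_trans ak _.
Qed.

Lemma spine_cons k : spine hb k = head k (spine hb k) :: behead (spine hb k).
Proof. by rewrite spineE; case: (hb k) => [[a b]|//]; case: (spine hb a). Qed.

Lemma spine_behead k a b : hb k = Some (a, b) ->
  behead (spine hb k) = rcons (behead (spine hb a)) b.
Proof. by move=> kE; rewrite [spine hb k]spineE kE; rewrite {1}(spine_cons a). Qed.

Lemma spine_head k a b : hb k = Some (a, b) ->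
  head k (spine hb k) = head a (spine hb a).
Proof. by move=> kE; rewrite [spine hb k]spineE kE spine_cons. Qed.

Lemma spine_head_gen k : hb (head k (spine hb k)) = None.
Proof.
elim/hall_ind: k => [k kE|k a b kE IH _]; first by rewrite spineE kE.
by rewrite (spine_head kE).
Qed.

(** Hall's condition compares [b] only with the right factor of [a]; applied repeatedly down the
    left factors it bounds every earlier letter. *)
Lemma spine_last k a b c : hb k = Some (a, b) ->
  c \in behead (spine hb k) -> (c <= b)%N.
Proof.
elim/hall_ind: k a b => [k -> //|k a b kE IH _ a0 b0].
rewrite kE => -[_ <-]; rewrite (spine_behead kE) mem_rcons inE => /orP[/eqP->//|].
case aE : (hb a) => [[a' a'']|]; last by rewrite spineE aE.
by move=> /(IH _ _ aE)/leq_trans; apply; exact: hb_le kE aE.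
Qed.

Lemma spine_lt k c : c \in behead (spine hb k) -> (c < k)%N.
Proof.
case kE : (hb k) => [[a b]|]; last by rewrite spineE kE.
move=> /(spine_last kE) cb; have [ba ak] := hb_lt kE.
exact: leq_ltn_trans cb (ltn_trans ba ak).
Qed.

Lemma spine_sorted k : sorted (fun a b : 'I_n => a <= b)%N (behead (spine hb k)).
Proof.
elim/hall_ind: k => [k kE|k a b kE IH _]; first by rewrite spineE kE.
rewrite (spine_behead kE).
have : all (fun c : 'I_n => c <= b)%N (behead (spine hb a)).
  apply/allP => c ca; apply: (spine_last kE).
  by rewrite (spine_behead kE) mem_rcons inE ca orbT.
move: IH; case: (behead (spine hb a)) => [//|c t] /= pt /andP[cb tb].
rewrite rcons_path pt /=.
by have := mem_last c t; rewrite inE => /orP[/eqP->//|/(allP tb)].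
Qed.

Lemma spine_inj j k : spine hb j = spine hb k -> j = k.
Proof.
elim/hall_ind: j k => [j jE|j a b jE IHa _] k; rewrite (spineE j) (spineE k) jE.
  case: (hb k) => [[c d]|[]//].
  by rewrite spine_cons; case: (behead _).
case kE : (hb k) => [[c d]|]; last by rewrite spine_cons; case: (behead _).
move=> /eqP; rewrite eqseq_rcons => /andP[/eqP/IHa ac /eqP bd].
by apply: (hb_inj jE); rewrite kE ac bd.
Qed.

(** Letters are peeled off the right end. By induction the left factor of [l] would be [k], and
    Hall's condition then forces the last letter below [k]. *)
Lemma spine_cat k l t : spine hb l = spine hb k ++ t ->
  (forall c, c \in t -> (k <= c)%N) -> l = k.
Proof.
elim/hall_ind: l t => [l lE|l a b lE IH _] t.
  case: t => [|c t]; first by rewrite cats0 => /spine_inj.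
  by rewrite (spineE l) lE spine_cons; case: (behead _).
elim/last_ind: t => [|t c _]; first by rewrite cats0 => /spine_inj.
rewrite (spineE l) lE -rcons_cat => /eqP; rewrite eqseq_rcons => /andP[/eqP ak /eqP bc] tk.
have aE : a = k by apply: (IH _ ak) => d dt; apply: tk; rewrite mem_rcons inE dt orbT.
have [ba _] := hb_lt lE.
have := tk c; rewrite mem_rcons inE eqxx -bc -aE => /(_ isT).
by rewrite leqNgt ba.
Qed.

(* The extra letters of the longer spine are at least k, so in sorted order they
   come after the whole spine of k; but [X_k, X_c] is a Hall element only for c < k. *)
Lemma spine_count_inj k l :
  head k (spine hb k) = head l (spine hb l) ->
  (forall c : 'I_n, (c < k)%N -> Iidx hb k c = Iidx hb l c) -> l = k.
Proof.
move=> hkl eq_kl; set S := behead (spine hb l).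
pose ltk := fun c : 'I_n => (c < k)%N.
have trans_le : transitive (fun a b : 'I_n => a <= b)%N by move=> ? ? ?; exact: leq_trans.
have anti_le : antisymmetric (fun a b : 'I_n => a <= b)%N.
  by move=> a b ab; apply/val_inj/anti_leq.
have srt (p : pred 'I_n) : sorted (fun a b : 'I_n => a <= b)%N (seq.filter p S).
  exact/(sorted_filter trans_le)/spine_sorted.
(* Every letter of the spine of [k] is below [k], and a sorted list is determined by its counts. *)
have kE : behead (spine hb k) = seq.filter ltk S.
  apply: (sorted_eq trans_le anti_le (spine_sorted k) (srt _)).
  apply/allP => c _ /=; rewrite count_filter; apply/eqP.
  have [ck|ck] := boolP (ltk c).
    rewrite -[LHS]/(Iidx hb k c) eq_kl//.
    by apply: eq_count => d /=; case: eqP => // ->.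
  rewrite (count_memPn _); last by apply/negP => /spine_lt; exact/negP.
  apply/esym/eqP; rewrite -leqn0 leqNgt -has_count.
  by apply/hasPn => d _ /=; case: eqP => // ->.
have SE : S = seq.filter ltk S ++ seq.filter (predC ltk) S.
  apply: (sorted_eq trans_le anti_le (spine_sorted l)); last first.
    by rewrite perm_sym perm_filterC.
  move: (srt ltk) (srt (predC ltk)); rewrite !(sorted_pairwise trans_le) pairwise_cat => -> ->.
  rewrite !andbT; apply/allrelP => a b; rewrite !mem_filter /ltk /= -leqNgt.
  by move=> /andP[ak _] /andP[kb _]; exact: leq_trans (ltnW ak) kb.
apply: (@spine_cat k l (seq.filter (predC ltk) S)); last first.
  by move=> c; rewrite mem_filter /= /ltk -leqNgt => /andP[].
by rewrite (spine_cons l) (spine_cons k) kE hkl /= -SE.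
Qed.

End HallCombinatorics.

(** * Derivatives of monomials, and restriction to coordinate subspaces *)

Section MonomialDerivatives.
Variables (R : realType) (n : nat).
Implicit Types (f g : 'rV[R]_n -> R) (x : 'rV[R]_n) (j k : 'I_n).
Implicit Types (al : 'I_n -> nat) (t : seq 'I_n).

Lemma polyf_xpow al : polyf (fun x : 'rV[R]_n => xpow x al).
Proof. by apply: polyf_prod => j; apply: polyf_exp; exact: polyf_coord. Qed.

Lemma pd_exp k m f : polyf f ->
  pd k (fun x => f x ^+ m) = (fun x => m%:R * f x ^+ m.-1 * pd k f x).
Proof.
move=> pf; elim: m => [|m IH].
  under eq_fun do rewrite expr0.
  by rewrite pd_cst; apply/funext => x; rewrite mul0r mul0r.
under eq_fun do rewrite exprS.
rewrite (pd_mul k pf (polyf_exp m pf)) IH; apply/funext => x /=.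
case: m {IH} => [|m]; first by rewrite expr0; ring.
by rewrite exprS -(natr1 m.+1); ring.
Qed.

Lemma pd_prod0 k I (s : seq I) (P : pred I) (F : I -> 'rV[R]_n -> R) :
  (forall i, polyf (F i)) -> (forall i, P i -> pd k (F i) = fun=> 0) ->
  pd k (fun x => \prod_(i <- s | P i) F i x) = fun=> 0.
Proof.
move=> pF F0; elim: s => [|i s IHs].
  under eq_fun do rewrite big_nil.
  by rewrite pd_cst.
under eq_fun do rewrite big_cons.
case Pi: (P i) => //.
rewrite (pd_mul k (pF i) (polyf_prod _ _ pF)) IHs F0//.
by apply/funext => x; rewrite mul0r mulr0 addr0.
Qed.

(** The truncated subtraction is harmless: when the exponent of [k] is 0, so is the coefficient in
    front. *)
Lemma pd_xpow k al :
  pd k (fun x : 'rV[R]_n => xpow x al) =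
  (fun x => (al k)%:R * xpow x (fun j => al j - (k == j))%N).
Proof.
have pr al' : polyf (fun x : 'rV[R]_n => \prod_(j | j != k) x ord0 j ^+ al' j).
  by apply: polyf_prod => j; apply: polyf_exp; exact: polyf_coord.
have pk m : polyf (fun x : 'rV[R]_n => x ord0 k ^+ m).
  by apply: polyf_exp; exact: polyf_coord.
have xE al' : (fun x : 'rV[R]_n => xpow x al') =
    (fun x => x ord0 k ^+ al' k * \prod_(j | j != k) x ord0 j ^+ al' j).
  by apply/funext => x; rewrite /xpow (bigD1 k).
rewrite xE (pd_mul k (pk _) (pr _)) (pd_exp k _ (polyf_coord R k)) (pd_coord R k k).
rewrite pd_prod0; last 2 first.
- by move=> j; apply: polyf_exp; exact: polyf_coord.
- move=> j jk; rewrite (pd_exp k _ (polyf_coord R j)) (pd_coord R k j).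
  by apply/funext => x; rewrite eq_sym (negbTE jk) mulr0.
apply/funext => x; rewrite mulr0 addr0 eqxx mulr1 -mulrA; congr (_ * _).
rewrite /xpow [RHS](bigD1 k)//= eqxx subn1; congr (_ * _).
by apply: eq_bigr => j; rewrite eq_sym => /negbTE ->; rewrite subn0.
Qed.

Definition pds t f := foldl (fun f k => pd k f) f t.

Lemma polyf_pds t f : polyf f -> polyf (pds t f).
Proof. by elim: t f => //= k t IH f pf; apply: IH; exact: polyf_pd. Qed.

Lemma pds_rcons t k f : pds (rcons t k) f = pd k (pds t f).
Proof. by rewrite /pds -cats1 foldl_cat. Qed.

Lemma pds_cst0 t : pds t (fun=> 0) = (fun=> 0).
Proof. by elim: t => //= k t; rewrite pd_cst. Qed.

(** The falling factorials vanish as soon as [t] repeats an index more often than the monomial does,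
    which absorbs the truncated exponents. *)
Lemma pds_monomial t (c : R) al :
  pds t (fun x => c * xpow x al) =
  (fun x => c * (\prod_j al j ^_ count_mem j t)%:R *
            xpow x (fun j => al j - count_mem j t)%N).
Proof.
elim: t c al => [|k t IH] c al.
  apply/funext => x /=; rewrite big1 ?mulr1//; congr (_ * xpow x _).
  by apply/funext => j; rewrite subn0.
have -> : pds (k :: t) (fun x => c * xpow x al) =
    pds t (fun x => (c * (al k)%:R) * xpow x (fun j => al j - (k == j))%N).
  rewrite /=; congr pds; rewrite (pd_mul k (polyf_cst _ c) (polyf_xpow al)).
  by rewrite pd_cst pd_xpow; apply/funext => x; rewrite mul0r add0r mulrA.
rewrite IH; apply/funext => x; congr (_ * _); last first.
  by congr (xpow x); apply/funext => j /=; rewrite subnDA.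
rewrite -mulrA -natrM (bigD1 k)//= [in RHS](bigD1 k)//= eqxx subn1 mulnA -ffactnS.
congr (_ * (_ * _)%:R); apply: eq_bigr => j; rewrite eq_sym => /negbTE ->.
by rewrite subn0.
Qed.

(** The subspace H_b: all of R^n for [b = 0], the origin alone for [b = n]. *)
Definition vanish_below (b : nat) x := forall i : 'I_n, (i < b)%N -> x ord0 i = 0.

Lemma vanish_below_le a b x : (a <= b)%N -> vanish_below b x -> vanish_below a x.
Proof. by move=> ab xb i ia; apply: xb; exact: leq_trans ab. Qed.

Lemma vanish_below_line b x k (t : R) : (b <= k)%N -> vanish_below b x ->
  vanish_below b (x + t *: delta_mx ord0 k).
Proof.
move=> bk xb i ib; rewrite !mxE xb// add0r (_ : i == k = false) ?andbF ?mulr0//.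
by apply/negbTE; apply: contraTneq ib => ->; rewrite -leqNgt.
Qed.

(** An axis of index at least [b] is tangent to H_b, so the derivative along it sees only the values
    on H_b. Identities that hold only on H_b can thus be differentiated. *)
Lemma pd_vanish_below b f g k x : polyf f -> polyf g ->
  (forall y, vanish_below b y -> f y = g y) -> (b <= k)%N -> vanish_below b x ->
  pd k f x = pd k g x.
Proof.
move=> pf pg fg bk xb.
have := derive_line x k 0 pf; have := derive_line x k 0 pg.
rewrite scale0r addr0 => -[_ <-] [_ <-]; congr (derive _ (0 : R) (1 : R)).
by apply/funext => t; apply: fg; exact: vanish_below_line.
Qed.

End MonomialDerivatives.

(** * The Hall fields: homogeneity, and values on the subspaces H_k *)

Section HallFields.
Variables (R : realType) (r s n : nat) (hb : 'I_n -> option ('I_n * 'I_n)).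
Variable w : 'I_n -> nat.
Hypothesis Hhall : hall_basis r s n hb w.
Implicit Types (i j k l a b : 'I_n) (x : 'rV[R]_n).

Lemma hgg_f_fuel f f' k : (k < f)%N -> (k < f')%N ->
  hgg_f R hb f k = hgg_f R hb f' k.
Proof.
elim: f f' k => // f IH [//|f'] k kf kf' /=.
case kE : (hb k) => [[a b]|//]; have [ba ak] := hb_lt Hhall kE.
have bk := ltn_trans ba ak.
by rewrite (IH f' a) ?(IH f' b)//;
  (exact: leq_trans ak _) || exact: leq_trans bk _.
Qed.

Lemma HGGE k : HGG R hb k =
  if hb k is Some (a, b) then brk (HGG R hb a) (HGG R hb b) else gg_gen R hb k.
Proof.
suff H f : (k < f)%N -> hgg_f R hb f k =
    if hb k is Some (a, b) then brk (HGG R hb a) (HGG R hb b) else gg_gen R hb k.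
  exact: H.
case: f => //= f kf; case kE : (hb k) => [[a b]|//]; have [ba ak] := hb_lt Hhall kE.
have bk := ltn_trans ba ak; rewrite brk.unlock /HGG.
by rewrite (@hgg_f_fuel f n a) ?(@hgg_f_fuel f n b)//;
  (exact: leq_trans ak _) || exact: leq_trans bk _.
Qed.

Lemma Iidx_rec k a b : hb k = Some (a, b) ->
  Iidx hb k = fun j => (Iidx hb a j + (b == j))%N.
Proof.
move=> kE; apply/funext => j.
by rewrite /Iidx (spine_behead Hhall kE) -cats1 count_cat /= addn0.
Qed.

Lemma Iidx_gen k : hb k = None -> Iidx hb k = fun=> 0%N.
Proof. by move=> kE; apply/funext => j; rewrite /Iidx (spineE Hhall) kE. Qed.

(** The successor accounts for the head of the spine, a generator of weight 1. Hence the monomial at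
    d_l in a generator field has degree [w l - 1]. *)
Lemma w_Iidx k : w k = (\sum_j Iidx hb k j * w j).+1.
Proof.
elim/(hall_ind Hhall): k => [k kE|k a b kE IH _].
  by rewrite (w_gen Hhall kE) (Iidx_gen kE) big1.
rewrite (hb_w Hhall kE) (Iidx_rec kE) IH.
under [in RHS]eq_bigr do rewrite mulnDl.
rewrite big_split /= addSn; congr (_ + _).+1.
by rewrite (bigD1 b)//= eqxx mul1n big1 ?addn0// => j; rewrite eq_sym => /negbTE ->.
Qed.

Lemma mabs_Iidx k : mabs (Iidx hb k) = size (behead (spine hb k)).
Proof.
rewrite /mabs; elim/(hall_ind Hhall): k => [k kE|k a b kE IH _].
  by rewrite (Iidx_gen kE) (spineE Hhall) kE big1.
rewrite (Iidx_rec kE) (spine_behead Hhall kE) size_rcons -IH big_split /= -addn1.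
by congr (_ + _)%N; rewrite (bigD1 b)//= eqxx big1// => j; rewrite eq_sym => /negbTE ->.
Qed.

Lemma gg_genE i x l : gg_gen R hb i x ord0 l =
  if head l (spine hb l) == i then
    (-1) ^+ mabs (Iidx hb l) / (mfact (Iidx hb l))%:R * xpow x (Iidx hb l)
  else 0.
Proof. by rewrite mxE. Qed.

Lemma homvf_HGG k : homvf w (w k) (HGG R hb k).
Proof.
elim/(hall_ind Hhall): k => [k kE|k a b kE IHa IHb]; rewrite HGGE kE.
  move=> l; rewrite (w_gen Hhall kE).
  under eq_fun do rewrite gg_genE.
  case: eqP => _; last exact: homf_zero.
  rewrite (w_Iidx l) (_ : _ - _ = 0 + (\sum_j Iidx hb l j * w j)%N%:Z); last by lia.
  by apply: homf_mul; [exact: homf_cst|exact: homf_xpow].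
by rewrite (hb_w Hhall kE); exact: homvf_brk.
Qed.

Lemma polyvf_HGG k : polyvf (HGG R hb k).
Proof. exact: homvf_polyvf (homvf_HGG k). Qed.

Lemma polyf_gg_gen i l : hb i = None -> polyf (fun x => gg_gen R hb i x ord0 l).
Proof. by move=> iE; have := polyvf_HGG i l; rewrite HGGE iE. Qed.

(* X_k agrees with (-1)^h d_{l_h} ... d_{l_1} X_{l_0} where the coordinates below l_h vanish. *)
Definition spine_formula k := forall x i,
  (forall c, c \in behead (spine hb k) -> vanish_below c x) ->
  HGG R hb k x ord0 i = (-1) ^+ size (behead (spine hb k)) *
    pds (behead (spine hb k))
      (fun y => gg_gen R hb (head k (spine hb k)) y ord0 i) x.

(** By the formula, component [l] is a multiple of x^(I(l) - I(k)) for spines with the same head. On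
    H_k it survives only if I(l) and I(k) agree below [k], and then [spine_count_inj] gives
    [l = k]. *)
Lemma HGG_vanish_below_of_formula k x : spine_formula k -> vanish_below k x ->
  HGG R hb k x = delta_mx ord0 k.
Proof.
move=> Fk xk; apply/rowP => l; rewrite mxE eqxx /= Fk; last first.
  by move=> c /(spine_lt Hhall) ck; apply: vanish_below_le xk; exact: ltnW.
under eq_fun do rewrite gg_genE.
case: eqP => [hE|hE]; last first.
  rewrite pds_cst0 mulr0; case: eqP => // lk.
  by case: hE; rewrite lk.
rewrite pds_monomial.
(* For [l = k] the derivative of x^I(k) is I(k)!, which cancels the denominator, and the two signs
   multiply to 1. *)
have [->|lk] := eqVneq l k.
  rewrite mabs_Iidx /mfact /Iidx.
  under eq_bigr do rewrite ffactnn.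
  rewrite [xpow _ _]big1; last by move=> j _; rewrite subnn.
  rewrite mulr1 divfK; last by rewrite pnatr_eq0 -lt0n prodn_gt0// => j; exact: fact_gt0.
  by rewrite -exprD addnn -signr_odd odd_double.
apply/eqP; rewrite !mulf_eq0.
have [cE|] := boolP [forall c : 'I_n, (c < k)%N ==> (Iidx hb k c == Iidx hb l c)].
  case/eqP: lk; apply: (spine_count_inj Hhall) => // c ck.
  by apply/eqP; move/forallP: cE => /(_ c)/implyP; apply.
rewrite negb_forall => /existsP[c]; rewrite negb_imply => /andP[ck].
(* If I(l) exceeds I(k) at [c], a positive power of the vanishing x_c remains; otherwise a falling
   factorial is 0. *)
rewrite neq_ltn => /orP[lt_c|lt_c]; apply/orP; right; apply/orP.
  right; rewrite /xpow (bigD1 c)//= xk// expr0n subn_eq0 leqNgt lt_c mul0r//.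
left; apply/orP; right; rewrite pnatr_eq0 (bigD1 c)//= muln_eq0.
by apply/orP; left; rewrite ffact_small.
Qed.

(** Such a component has degree at most 0, hence is constant, and its value can be read at the
    origin. *)
Lemma HGG_low_of_formula k x j : spine_formula k -> (w j <= w k)%N ->
  HGG R hb k x ord0 j = (j == k)%:R.
Proof.
move=> Fk; have hH := homvf_HGG k j.
have -> : (j == k)%:R = HGG R hb k 0 ord0 j.
  rewrite (HGG_vanish_below_of_formula Fk); first by rewrite mxE eqxx.
  by move=> i _; rewrite mxE.
rewrite leq_eqVlt => /orP[/eqP jk|jk].
  by move: hH; rewrite jk subrr => /(homf_eq0 (w_gt0 Hhall))/(congr1 (@^~ x)).
have /(homf_lt0 (w_gt0 Hhall) hH) H0 : (w j)%:Z - (w k)%:Z < 0 by rewrite subr_lt0 ltz_nat.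
by rewrite (congr1 (@^~ x) H0) (congr1 (@^~ 0) H0).
Qed.

(** For X_k = [X_a, X_b] at a point of H_b, the derivative of X_b along X_a is zero: X_a has only
    directions of index at least [a > b], and X_b is constant along them in H_b. What remains is
    -d_b X_a, and the formula for X_a holds throughout H_b because the letters of [a] are at most
    [b]. *)
Lemma spine_formulaP k : spine_formula k.
Proof.
elim/(hall_ind Hhall): k => [k kE|k a b kE Fa Fb] x i xT.
  by rewrite HGGE (spineE Hhall) kE /= expr0 mul1r.
have [ba ak] := hb_lt Hhall kE.
have bT : b \in behead (spine hb k) by rewrite (spine_behead Hhall kE) mem_rcons inE eqxx.
have gen := spine_head_gen Hhall a.
rewrite HGGE kE brkE; [|exact: polyvf_HGG|exact: polyvf_HGG].
rewrite [lder _ _ _]big1 ?add0r; last first.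
  move=> j _; have [ja|aj] := ltnP j a.
    by rewrite (HGG_low_of_formula _ Fa) ?(w_mono Hhall (ltnW ja))//
      (_ : j == a = false) ?mul0r//; apply/negbTE; rewrite neq_ltn ja.
  rewrite (@pd_vanish_below _ _ b _ (fun=> (delta_mx ord0 b : 'rV[R]_n) ord0 i)).
  - by rewrite pd_cst mulr0.
  - exact: polyvf_HGG.
  - exact: polyf_cst.
  - by move=> y yb; rewrite (HGG_vanish_below_of_formula Fb yb).
  - exact: leq_trans (ltnW ba) aj.
  - exact: xT.
rewrite /lder (HGG_vanish_below_of_formula Fb (xT _ bT)) (bigD1 b)//= big1 ?addr0; last first.
  by move=> j jb; rewrite mxE (negbTE jb) andbF mul0r.
rewrite mxE !eqxx mul1r.
have pgg := polyf_pds (behead (spine hb a)) (polyf_gg_gen i gen).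
have pc := polyf_cst n ((-1 : R) ^+ size (behead (spine hb a))).
rewrite (pd_vanish_below (polyvf_HGG a i) (polyf_mul pc pgg) _ (leqnn b) (xT _ bT)); last first.
  move=> y yb; apply: Fa => c ca; apply: vanish_below_le yb.
  by apply: (spine_last Hhall kE); rewrite (spine_behead Hhall kE) mem_rcons inE ca orbT.
rewrite (pd_mul b pc pgg) pd_cst mul0r add0r.
by rewrite (spine_behead Hhall kE) (spine_head Hhall kE) size_rcons pds_rcons exprS mulN1r mulNr.
Qed.

Lemma HGG_vanish_below k x : vanish_below k x -> HGG R hb k x = delta_mx ord0 k.
Proof. exact/HGG_vanish_below_of_formula/spine_formulaP. Qed.

Lemma HGG_low k x j : (w j <= w k)%N -> HGG R hb k x ord0 j = (j == k)%:R.
Proof. exact/HGG_low_of_formula/spine_formulaP. Qed.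

Lemma HGG_lt k x j : (j < k)%N -> HGG R hb k x ord0 j = 0.
Proof.
move=> jk; rewrite HGG_low ?(w_mono Hhall (ltnW jk))//.
by rewrite (_ : j == k = false)//; apply/negbTE; rewrite neq_ltn jk.
Qed.

End HallFields.

(** * Closure of the graded span of the Hall fields under brackets *)

Section HallSpanning.
Variables (R : realType) (r s n : nat) (hb : 'I_n -> option ('I_n * 'I_n)).
Variable w : 'I_n -> nat.
Hypothesis Hhall : hall_basis r s n hb w.
Implicit Types (i j k l a b : 'I_n) (x : 'rV[R]_n) (Y Z : VF R n).
Local Notation X := (HGG R hb).
Let pX := polyvf_HGG R Hhall.

Definition hall_span (W : nat) Z := exists c : 'I_n -> R,
  (forall k, c k != 0 -> w k = W) /\ Z = fun x => \sum_k c k *: X k x.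

Lemma hall_span_basis k : hall_span (w k) (X k).
Proof.
exists (fun l => (l == k)%:R); split=> [l|]; first by case: (eqVneq l k) => [->//|_]; rewrite eqxx.
apply/funext => x; rewrite (bigD1 k)//= eqxx scale1r big1 ?addr0// => l /negbTE ->.
by rewrite scale0r.
Qed.

Lemma hall_span0 W : hall_span W (fun=> 0).
Proof.
exists (fun=> 0); split=> [k|]; first by rewrite eqxx.
by apply/funext => x; rewrite big1// => k _; rewrite scale0r.
Qed.

Lemma hall_span_add W (a b : R) Y Z : hall_span W Y -> hall_span W Z ->
  hall_span W (fun x => a *: Y x + b *: Z x).
Proof.
move=> [c [cW ->]] [d [dW ->]]; exists (fun k => a * c k + b * d k); split=> [k|].
  have [-> //|/cW//] := eqVneq (c k) 0; have [->|/dW//] := eqVneq (d k) 0.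
  by rewrite !mulr0 addr0 eqxx.
apply/funext => x; rewrite !scaler_sumr -big_split /=; apply: eq_bigr => k _.
by rewrite scalerDl !scalerA.
Qed.

Lemma hall_span_sum W (c : 'I_n -> R) (Z : 'I_n -> VF R n) :
  (forall k, c k != 0 -> hall_span W (Z k)) ->
  hall_span W (fun x => \sum_k c k *: Z k x).
Proof.
move=> cZ; elim: (index_enum _) => [|k t IH].
  by under eq_fun do rewrite big_nil; exact: hall_span0.
under eq_fun do rewrite big_cons.
have [->|ck] := eqVneq (c k) 0.
  by under eq_fun do rewrite scale0r add0r.
have := hall_span_add (c k) 1 (cZ _ ck) IH.
by under eq_fun do rewrite scale1r.
Qed.

Lemma hall_span_brkC a b : hall_span (w a + w b) (brk (X a) (X b)) ->
  hall_span (w b + w a) (brk (X b) (X a)).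
Proof.
move=> ab; rewrite addnC brkN.
have := hall_span_add (-1) 0 ab ab.
by under eq_fun do rewrite scale0r addr0 scaleN1r.
Qed.

Lemma brkXX Y : brk Y Y = (fun=> 0).
Proof.
apply/funext => x; have /(congr1 (@^~ x))/eqP := brkN Y Y.
by rewrite -subr_eq0 opprK -mulr2n -scaler_nat scaler_eq0 pnatr_eq0 => /eqP.
Qed.

(* M. Hall's rewriting: if X_a = [X_a', X_a''] with b < a'', Jacobi replaces
   [X_a, X_b] by brackets of the same weight whose factors all come after b. *)
Lemma hall_span_brk a b : hall_span (w a + w b) (brk (X a) (X b)).
Proof.
have [N] := ubnP (w a + w b)%N; elim: N a b => // N IHN a b abN.
(* Lexicographic induction: first on the total weight, then on how far the smaller index lies from
   the top. *)
have [m] := ubnP (n - minn a b)%N; elim: m a b abN => // m IHm a b abN abm.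
wlog ba : a b abN abm / (b < a)%N.
  move=> H; have [ab|ba|/val_inj ->] := ltngtP a b.
  - by apply: hall_span_brkC; apply: H => //; [rewrite addnC|rewrite minnC].
  - exact: H.
  - by rewrite brkXX; exact: hall_span0.
have [abs|sab] := leqP (w a + w b) s; last first.
  suff -> : brk (X a) (X b) = (fun=> 0) by exact: hall_span0.
  apply/funext => x; apply/rowP => i.
  have := homvf_brk (homvf_HGG R Hhall a) (homvf_HGG R Hhall b) i.
  move=> /(homf_lt0 (w_gt0 Hhall)) H.
  have /H/(congr1 (@^~ x)) -> : (w i)%:Z - (w a + w b)%N%:Z < 0.
    by rewrite subr_lt0 ltz_nat; exact: leq_ltn_trans (w_les Hhall i) sab.
  by rewrite mxE.
have [[a' [a'' [aE ba'']]]|noj] :=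
    pselect (exists a' a'', hb a = Some (a', a'') /\ (b < a'')%N); last first.
  have [k kE] : exists k, hb k = Some (a, b).
    apply: (hb_ex Hhall) => // a' a'' aE; rewrite leqNgt; apply/negP => ba''.
    by apply: noj; exists a', a''.
  rewrite -(hb_w Hhall kE).
  by have := hall_span_basis k; rewrite [X k](HGGE _ Hhall) kE.
have [a''a' a'a] := hb_lt Hhall aE.
have wE := hb_w Hhall aE.
have [wa' wa''] := (w_gt0 Hhall a', w_gt0 Hhall a'').
(* The inner bracket is lighter, so the outer induction expands it. Its terms X_k are heavier than
   X_b, whence [b < k]; each [X_k, X_q] keeps the total weight but has a larger smallest index. *)
have expand (p q : 'I_n) : (b < q)%N -> (w p + w q = w a)%N -> (0 < w q)%N -> (0 < w p)%N ->
    hall_span (w a + w b) (brk (brk (X p) (X b)) (X q)).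
  move=> bq pqw q0 p0.
  have [|c [cW ->]] := IHN p b; first by lia.
  rewrite brk_combl//; apply: hall_span_sum => k /cW kw.
  have bk : (b < k)%N by apply: (w_lt Hhall); lia.
  have -> : (w a + w b = w k + w q)%N by lia.
  by apply: IHm; [lia|have := ltn_ord k; have := ltn_ord q; lia].
rewrite [X a](HGGE _ Hhall) aE jacobi//.
have e1 : hall_span (w a + w b) (brk (brk (X a') (X b)) (X a'')).
  by apply: expand => //; lia.
have e2 : hall_span (w a + w b) (brk (brk (X a'') (X b)) (X a')).
  by apply: expand => //; lia.
have := hall_span_add 1 (-1) e1 e2.
by under eq_fun do rewrite scale1r scaleN1r.
Qed.

End HallSpanning.

(** * Structure constants, adjoint matrices and the ordered exponential product *)

Section AdjointExponential.
Variables (R : realType) (r s n : nat) (hb : 'I_n -> option ('I_n * 'I_n)).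
Variable w : 'I_n -> nat.
Hypothesis Hhall : hall_basis r s n hb w.
Implicit Types (i j k l a b p q : 'I_n) (x y : 'rV[R]_n).
Local Notation X := (HGG R hb).
Let pX := polyvf_HGG R Hhall.

Definition structure_const a b : 'I_n -> R :=
  sval (cid (hall_span_brk R Hhall a b)).

Lemma structure_const_w a b k : structure_const a b k != 0 -> w k = (w a + w b)%N.
Proof. by rewrite /structure_const; case: cid => c [cw _] /=; exact: cw. Qed.

Lemma structure_constE a b :
  brk (X a) (X b) = fun x => \sum_k structure_const a b k *: X k x.
Proof. by rewrite /structure_const; case: cid => c []. Qed.

(** At the origin the Hall fields are the standard basis. This uniqueness also identifies the
    constants selected by [gsc]. *)
Lemma HGG_free (c d : 'I_n -> R) :
  (fun x => \sum_k c k *: X k x) = (fun x => \sum_k d k *: X k x) -> c = d.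
Proof.
have at0 (e : 'I_n -> R) i : (\sum_k e k *: X k 0) ord0 i = e i.
  rewrite summxE (bigD1 i)//= big1 ?addr0 => [|k ki].
    by rewrite mxE (HGG_vanish_below Hhall) ?mxE ?eqxx ?mulr1// => j _; rewrite mxE.
  rewrite mxE (HGG_vanish_below Hhall) ?mxE; last by move=> j _; rewrite mxE.
  by rewrite eq_sym (negbTE ki) andbF mulr0.
by move=> /(congr1 (@^~ 0)) cd; apply/funext => i; rewrite -at0 cd at0.
Qed.

Definition admx j : 'M[R]_n := \matrix_(k, l) structure_const j k l.

Lemma admx_neq0 j k l : admx j k l != 0 -> w l = (w j + w k)%N.
Proof. by rewrite mxE; exact: structure_const_w. Qed.

(** The Jacobi identity in coordinates. The commutator is reversed because coordinates are stored in
    rows, so that composing adjoint maps reverses matrix products. *)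
Lemma admx_brk a b : \sum_l admx a b l *: admx l = admx b *m admx a - admx a *m admx b.
Proof.
apply/matrixP => p q; rewrite summxE !mxE.
pose c1 q' := \sum_l admx a b l * admx l p q'.
pose c2 q' := \sum_l admx b p l * admx a l q' - \sum_l admx a p l * admx b l q'.
suff /(congr1 (@^~ q)) : c1 = c2 by rewrite /c1 /c2 => <-; apply: eq_bigr => l _; rewrite mxE.
(* The index maps [d] and [e] let one identity cover all three sums, where [l] stands in the left or
   the right slot of the bracket. *)
have nest d e (c : 'I_n -> R) x : \sum_k (\sum_l c l * admx (d l) (e l) k) *: X k x =
    \sum_l c l *: brk (X (d l)) (X (e l)) x.
  under [RHS]eq_bigr do rewrite structure_constE scaler_sumr.
  rewrite exchange_big /=; apply: eq_bigr => k _; rewrite scaler_suml.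
  by apply: eq_bigr => l _; rewrite scalerA mxE.
apply: HGG_free; apply/funext => x; rewrite /c2.
under [RHS]eq_bigr do rewrite scalerBl.
rewrite sumrB (nest id (fun=> p)) (nest (fun=> a) id) (nest (fun=> b) id).
have sE' d e : brk (X d) (X e) = fun y => \sum_l admx d e l *: X l y.
  by rewrite structure_constE; apply/funext => y; apply: eq_bigr => l _; rewrite mxE.
have := jacobi (pX a) (pX b) (pX p) => /(congr1 (@^~ x)).
rewrite [brk (brk (X a) (X p)) _]brkN [brk (brk (X b) (X p)) _]brkN opprK addrC.
rewrite (sE' a b) (sE' a p) (sE' b p).
by rewrite (brk_combl _ _ pX (pX p)) !(brk_combr _ _ pX) => // ->.
Qed.

Lemma admx_exp_neq0 j m k l : (admx j ^+ m) k l != 0 -> (w k + m <= w l)%N.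
Proof.
elim: m k => [|m IH] k.
  by rewrite expr0 mxE; case: (eqVneq k l) => [-> _|_]; rewrite ?addn0// eqxx.
rewrite exprS mxE => sum0.
have [i] : exists i, admx j k i * (admx j ^+ m) i l != 0.
  apply: contrapT => no; case/eqP: sum0; apply: big1 => i _.
  by apply/eqP; apply: contrapT => /negP ?; apply: no; exists i.
rewrite mulf_eq0 negb_or => /andP[/admx_neq0 wi /IH].
by have := w_gt0 Hhall j; lia.
Qed.

Lemma admx_nilp j : admx j ^+ s.+1 = 0.
Proof.
apply/matrixP => k l; rewrite [RHS]mxE; apply/eqP; apply: contrapT => /negP.
by move=> /admx_exp_neq0; have := w_les Hhall l; lia.
Qed.

(** The full exponential of y ad X_j: by [admx_nilp] the omitted powers are zero. *)
Definition expad j (y : R) : 'M[R]_n :=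
  \sum_(m < s.+1) (y ^+ m / m`!%:R) *: admx j ^+ m.

Lemma expad0 j : expad j 0 = 1.
Proof.
rewrite /expad big_ord_recl /= expr0 fact0 divr1 scale1r expr0 big1 ?addr0// => i _.
by rewrite /bump /= expr0n mul0r scale0r.
Qed.

Definition adexp x : 'M[R]_n := \prod_j expad j (x ord0 j).

Lemma adexp0 : adexp 0 = 1%:M.
Proof. by rewrite /adexp big1// => j _; rewrite mxE expad0. Qed.

Definition polymx (F : 'rV[R]_n -> 'M[R]_n) := forall p q, polyf (fun x => F x p q).

Lemma polymx_expad j : polymx (fun x => expad j (x ord0 j)).
Proof.
move=> p q; rewrite /expad; under eq_fun do rewrite summxE.
apply: polyf_sum => m; under eq_fun do rewrite mxE.
apply: polyf_mul; last exact: polyf_cst.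
by apply: polyf_mul; [apply: polyf_exp; exact: polyf_coord|exact: polyf_cst].
Qed.

Lemma polymx_mul F G : polymx F -> polymx G -> polymx (fun x => F x * G x).
Proof.
move=> pF pG p q; under eq_fun do rewrite mxE.
by apply: polyf_sum => l; exact: polyf_mul.
Qed.

Lemma polymx_prod (t : seq 'I_n) (P : pred 'I_n) F :
  (forall j, polymx (F j)) -> polymx (fun x => \prod_(j <- t | P j) F j x).
Proof.
move=> pF; elim: t => [|j t IH].
  by move=> p q; under eq_fun do rewrite big_nil; exact: polyf_cst.
case Pj : (P j); last by move=> p q; under eq_fun do rewrite big_cons Pj; exact: IH.
by move=> p q; under eq_fun do rewrite big_cons Pj; exact: polymx_mul.
Qed.

Lemma polymx_adexp : polymx adexp.
Proof. by apply: polymx_prod => j; exact: polymx_expad. Qed.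

Lemma pd_lin k (c : 'I_n -> R) (f : 'I_n -> 'rV[R]_n -> R) :
  (forall l, polyf (f l)) ->
  pd k (fun y => \sum_l c l * f l y) = (fun y => \sum_l c l * pd k (f l) y).
Proof.
move=> pf; rewrite pd_sum; last by move=> l; exact: polyf_mul (polyf_cst _ _) (pf l).
apply/funext => y; apply: eq_bigr => l _.
by rewrite (pd_mul k (polyf_cst _ (c l)) (pf l)) pd_cst mul0r add0r.
Qed.

Lemma mulr_scalemx (c : R) (A B : 'M[R]_n) : A * (c *: B) = c *: (A * B).
Proof. by rewrite [RHS]scalemxAr. Qed.

Lemma pd_expad k p q :
  pd k (fun x => expad k (x ord0 k) p q) =
  (fun x => (admx k * expad k (x ord0 k)) p q).
Proof.
have pm m : polyf (fun x : 'rV[R]_n => x ord0 k ^+ m / m`!%:R * (admx k ^+ m) p q).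
  apply: polyf_mul; last exact: polyf_cst.
  by apply: polyf_mul; [apply: polyf_exp; exact: polyf_coord|exact: polyf_cst].
rewrite /expad; under eq_fun do rewrite summxE.
under eq_fun do under eq_bigr do rewrite mxE.
rewrite (pd_sum _ _ _ (F := fun (m : 'I_s.+1) x => x ord0 k ^+ m / m`!%:R * (admx k ^+ m) p q))//.
apply/funext => x.
have pdm m : pd k (fun x : 'rV[R]_n => x ord0 k ^+ m / m`!%:R * (admx k ^+ m) p q) x =
    m%:R * x ord0 k ^+ m.-1 / m`!%:R * (admx k ^+ m) p q.
  have pe := polyf_exp m (polyf_coord R k).
  rewrite (pd_mul k (polyf_mul pe (polyf_cst _ _)) (polyf_cst _ _)) !pd_cst mulr0 addr0.
  rewrite (pd_mul k pe (polyf_cst _ _)) !pd_cst mulr0 addr0.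
  by rewrite (pd_exp k _ (polyf_coord R k)) (pd_coord R k k) eqxx mulr1.
under eq_bigr do rewrite pdm.
rewrite big_ord_recl /= !mul0r add0r.
(* Multiplying the truncated series by [admx k] creates a top power [s.+1], which vanishes; the
   other terms match after an index shift. *)
rewrite big_distrr /= big_ord_recr /= mulr_scalemx -exprS admx_nilp scaler0 addr0 summxE.
apply: eq_bigr => m _; rewrite mulr_scalemx -exprS mxE; congr (_ * _).
rewrite /bump /= add1n factS natrM invfM mulrACA mulfV ?mul1r//.
Qed.

(** The factors do not commute, so the first one is isolated by using that the enumeration of the
    indices is increasing. *)
Lemma prod_ge_split k (F : 'I_n -> 'M[R]_n) :
  \prod_(j < n | (k <= j)%N) F j = F k * \prod_(j < n | (k < j)%N) F j.
Proof.
have : sorted (fun a b : 'I_n => a < b)%N (index_enum 'I_n).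
  have -> : index_enum 'I_n = enum 'I_n by rewrite [index_enum _]unlock enumT.
  by have := iota_ltn_sorted 0 n; rewrite -val_enum_ord sorted_map.
have : k \in index_enum 'I_n by rewrite mem_index_enum.
elim: (index_enum 'I_n) => // j t IH; rewrite inE => kt jt.
have lt_j := order_path_min (fun a b c : 'I_n => @ltn_trans a b c) jt.
have {}IH := IH^~ (path_sorted jt).
rewrite !big_cons; move: kt; case: eqVneq => [-> _|kj /= kt].
  rewrite leqnn ltnn; congr (_ * _); rewrite [LHS]big_seq_cond [RHS]big_seq_cond.
  by apply: eq_bigl => i; case it : (i \in t) => //=; rewrite (allP lt_j _ it) ltnW// (allP lt_j).
have jk : (j < k)%N := allP lt_j _ kt.
by rewrite (leqNgt k j) jk (ltnNge k j) (ltnW jk) /= IH.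
Qed.

Definition adexp_tail k x : 'M[R]_n := \prod_(j < n | (k < j)%N) expad j (x ord0 j).

Lemma adexp_vanish_below k x : vanish_below k x ->
  adexp x = expad k (x ord0 k) * adexp_tail k x.
Proof.
move=> xk; rewrite -prod_ge_split [RHS]big_mkcond; apply: eq_bigr => j _.
by case: leqP => // jk; rewrite xk// expad0.
Qed.

Lemma pd_adexp_tail k p q : pd k (fun x => adexp_tail k x p q) = fun=> 0.
Proof.
rewrite /adexp_tail; elim: (index_enum _) p q => [|j t IH] p q.
  by under eq_fun do rewrite big_nil; rewrite pd_cst.
case kj : (k < j)%N; last by under eq_fun do rewrite big_cons kj; exact: IH.
under eq_fun do rewrite big_cons kj mxE.
have pt : polymx (fun x => \prod_(j <- t | (k < j)%N) expad j (x ord0 j)).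
  by apply: polymx_prod => i; exact: polymx_expad.
rewrite pd_sum; last by move=> l; exact: polyf_mul (polymx_expad _ _ _) (pt _ _).
apply/funext => x; apply: big1 => l _.
rewrite (pd_mul k (polymx_expad j p l) (pt l q)) IH mulr0 addr0.
rewrite (_ : pd k _ = fun=> 0) ?mul0r//.
have pm m : polyf (fun x : 'rV[R]_n => (x ord0 j ^+ m / m`!%:R)).
  by apply: polyf_mul; [apply: polyf_exp; exact: polyf_coord|exact: polyf_cst].
rewrite /expad; under eq_fun do rewrite summxE.
under eq_fun do under eq_bigr do rewrite mxE.
rewrite (pd_sum _ _ _ (F := fun (m : 'I_s.+1) x => x ord0 j ^+ m / m`!%:R * (admx j ^+ m) p l)).
  apply/funext => y; apply: big1 => m _.
  have pe := polyf_exp m (polyf_coord R j).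
  rewrite (pd_mul k (pm m) (polyf_cst _ _)) pd_cst mulr0 addr0.
  rewrite (pd_mul k pe (polyf_cst _ _)) pd_cst mulr0 addr0 (pd_exp k _ (polyf_coord R j)).
  by rewrite (pd_coord R k j) (_ : k == j = false) ?mulr0 ?mul0r//;
    apply/negbTE; rewrite neq_ltn kj.
by move=> m; exact: polyf_mul (pm m) (polyf_cst _ _).
Qed.

(** On H_k the factors before the [k]-th are the identity, so differentiating in x_k puts [admx k]
    at the far left. *)
Lemma pd_adexp k x p q : vanish_below k x ->
  pd k (fun y => adexp y p q) x = (admx k * adexp x) p q.
Proof.
move=> xk.
have pt : polymx (adexp_tail k) by apply: polymx_prod => i; exact: polymx_expad.
have pF := polymx_mul (polymx_expad k) pt.
rewrite (pd_vanish_below (polymx_adexp p q) (pF p q) _ (leqnn k) xk); last first.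
  by move=> y /adexp_vanish_below ->.
under eq_fun do rewrite mxE.
rewrite pd_sum; last by move=> l; exact: polyf_mul (polymx_expad _ _ _) (pt _ _).
rewrite (adexp_vanish_below xk) mulrA [RHS]mxE; apply: eq_bigr => l _.
by rewrite (pd_mul k (polymx_expad k p l) (pt l q)) pd_adexp_tail mulr0 addr0 pd_expad.
Qed.

End AdjointExponential.

(** * The identity X_j E = (ad X_j) E on the whole space *)

Section AdjointEquation.
Variables (R : realType) (r s n : nat) (hb : 'I_n -> option ('I_n * 'I_n)).
Variable w : 'I_n -> nat.
Hypothesis Hhall : hall_basis r s n hb w.
Implicit Types (i j k l a b p q : 'I_n) (x y : 'rV[R]_n).
Local Notation X := (HGG R hb).
Local Notation A := (admx R Hhall).
Local Notation Q := (adexp Hhall).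
Let pX := polyvf_HGG R Hhall.
Let pQ : polymx Q := polymx_adexp R Hhall.

Lemma brk_HGG j k x i :
  brk (X j) (X k) x ord0 i = \sum_l A j k l * X l x ord0 i.
Proof.
rewrite (structure_constE _ Hhall) summxE; apply: eq_bigr => l _.
by rewrite !mxE.
Qed.

Definition adexp_defect j p q x :=
  lder (X j) (fun y => Q y p q) x - (A j * Q x) p q.

Lemma polyf_mulQ (B : 'M[R]_n) p q : polyf (fun y => (B * Q y) p q).
Proof.
under eq_fun do rewrite mxE.
by apply: polyf_sum => l; apply: polyf_mul; [exact: polyf_cst|exact: pQ].
Qed.

Lemma polyf_adexp_defect j p q : polyf (adexp_defect j p q).
Proof. by apply: polyf_sub; [exact: polyf_lder|exact: polyf_mulQ]. Qed.

Lemma pd_mulQ k (B : 'M[R]_n) p q :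
  pd k (fun y => (B * Q y) p q) = fun y => \sum_l B p l * pd k (fun z => Q z l q) y.
Proof. by under eq_fun do rewrite mxE; rewrite pd_lin. Qed.

(** On H_k the field X_k is d_k, and X_j differentiates only along axes of index at least [j > k],
    where X_k stays constant. The bracket [X_k, X_j] thus reduces to d_k X_j. *)
Lemma pd_HGG_vanish k j i x : (k < j)%N -> vanish_below k x ->
  pd k (fun y => X j y ord0 i) x = \sum_l A k j l * X l x ord0 i.
Proof.
move=> kj xk; rewrite -brk_HGG brkE// [X in _ = _ - X]big1 ?subr0; last first.
  move=> m _; have [mj|jm] := ltnP m j; first by rewrite (HGG_lt Hhall)// mul0r.
  rewrite (pd_vanish_below (pX k i) (polyf_cst n ((delta_mx ord0 k : 'rV[R]_n) ord0 i))
    _ (leq_trans (ltnW kj) jm) xk) ?pd_cst ?mulr0//.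
  by move=> y yk; rewrite (HGG_vanish_below Hhall yk).
rewrite /lder (HGG_vanish_below Hhall xk) (bigD1 k)//= big1 ?addr0.
  by rewrite mxE !eqxx mul1r.
by move=> m mk; rewrite mxE (negbTE mk) andbF mul0r.
Qed.

Lemma pd_lder_adexp k j p q x : (k < j)%N -> vanish_below k x ->
  pd k (lder (X j) (fun y => Q y p q)) x =
  \sum_l A k j l * lder (X l) (fun y => Q y p q) x +
  \sum_l A k p l * lder (X j) (fun y => Q y l q) x.
Proof.
move=> kj xk; rewrite /lder pd_sum; last first.
  by move=> i; apply: polyf_mul; [exact: pX|exact/polyf_pd/pQ].
under eq_bigr => i _ do rewrite (pd_mul k (pX j i) (polyf_pd i (pQ p q))).
rewrite big_split /=; congr (_ + _).
  under eq_bigr do rewrite pd_HGG_vanish// big_distrl /=.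
  rewrite exchange_big /=; apply: eq_bigr => l _; rewrite big_distrr /=.
  by apply: eq_bigr => i _; rewrite mulrA.
under [RHS]eq_bigr do rewrite big_distrr /=.
rewrite exchange_big /=; apply: eq_bigr => i _.
have [ij|ji] := ltnP i j.
  rewrite (HGG_lt Hhall)// mul0r big1// => l _.
  by rewrite mul0r mulr0.
(* The remaining axes [i >= j] are tangent to H_k, so the identity for d_k E, valid on H_k only, may
   be differentiated along them. *)
rewrite pdC; last exact: pQ.
rewrite (pd_vanish_below (polyf_pd k (pQ p q)) (polyf_mulQ (A k) p q) _
  (leq_trans (ltnW kj) ji) xk); last by move=> y /(pd_adexp Hhall) ->.
by rewrite pd_mulQ big_distrr /=; apply: eq_bigr => l _; rewrite mulrCA.
Qed.

(** The terms without a defect add up to the expression that [admx_brk] makes zero, so the system is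
    homogeneous. *)
Lemma pd_adexp_defect k j p q x : (k < j)%N -> vanish_below k x ->
  pd k (adexp_defect j p q) x =
  \sum_l A k j l * adexp_defect l p q x + \sum_l A k p l * adexp_defect j l q x.
Proof.
move=> kj xk; rewrite /adexp_defect pd_add; last 2 first.
- exact: polyf_lder.
- exact/polyf_opp/polyf_mulQ.
rewrite pd_opp; last exact: polyf_mulQ.
rewrite pd_lder_adexp// pd_mulQ.
under [X in _ - X]eq_bigr do rewrite (pd_adexp Hhall)//.
under [X in _ = X + _]eq_bigr do rewrite mulrBr.
under [X in _ = _ + X]eq_bigr do rewrite mulrBr.
rewrite !sumrB addrACA; congr (_ + _); rewrite -opprD; congr (- _).
have E1 : \sum_l A j p l * (A k * Q x) l q = (A j * (A k * Q x)) p q by rewrite [RHS]mxE.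
have E2 : \sum_l A k p l * (A j * Q x) l q = (A k * (A j * Q x)) p q by rewrite [RHS]mxE.
have E3 : \sum_l A k j l * (A l * Q x) p q = ((\sum_l A k j l *: A l) * Q x) p q.
  rewrite mulr_suml summxE; apply: eq_bigr => l _.
  have -> : A k j l *: A l * Q x = A k j l *: (A l * Q x) by rewrite [RHS]scalemxAl.
  by rewrite [RHS]mxE.
rewrite E1 E2 E3 (admx_brk R Hhall k j) !mulrA.
rewrite -[A j *m A k]/(A j * A k) -[A k *m A j]/(A k * A j) mulrBl.
have subE (B C : 'M[R]_n) : B p q = (B - C) p q + C p q by rewrite !mxE subrK.
exact: subE.
Qed.

Lemma adexp_defect_eq0 (m : nat) j p q x : (m <= n)%N -> (m <= j)%N ->
  vanish_below m x -> adexp_defect j p q x = 0.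
Proof.
move=> mn; have [d] := ubnP (n - m)%N; elim: d m mn j p q x => // d IHd m mn j p q x.
move=> dm mj xm.
(* The induction starts for free: when [m = n] there is no [j] with [m <= j]. *)
have mn' : (m < n)%N by exact: leq_ltn_trans mj (ltn_ord j).
pose k := Ordinal mn'.
have xk : vanish_below k x by [].
have [jk|jk] := eqVneq j k.
  rewrite /adexp_defect jk /lder (HGG_vanish_below Hhall xk) (bigD1 k)//= big1 ?addr0.
    by rewrite mxE !eqxx mul1r (pd_adexp Hhall)// subrr.
  by move=> i ik; rewrite mxE (negbTE ik) andbF mul0r.
have kj : (k < j)%N by rewrite ltn_neqAle mj andbT eq_sym; exact: jk.
(* On H_k the defects solve a linear ODE in x_k that strictly raises w j + w p. *)
have [e] := ubnP (s + s - (w j + w p))%N.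
elim: e j p x xk kj {xm mj jk} => // e IHe j p x xk kj jpe.
have wj := w_gt0 Hhall k; have ls := w_les Hhall.
(* The inner induction makes the derivative of the defect along the [k]-th axis zero, so x_k may be
   replaced by 0, which puts the point in the next smaller subspace. *)
have -> : adexp_defect j p q x =
    adexp_defect j p q (x + (- x ord0 k) *: delta_mx ord0 k).
  apply/esym/line_cst => [|t]; first exact: polyf_adexp_defect.
  rewrite pd_adexp_defect//; last exact: vanish_below_line.
  rewrite !big1 ?addr0// => l _.
    have [-> |/(admx_neq0) wl] := eqVneq (A k p l) 0; first by rewrite mul0r.
    rewrite IHe ?mulr0//; first exact: vanish_below_line.
    by have := ls l; have := ls j; lia.
  have [-> |/(admx_neq0) wl] := eqVneq (A k j l) 0; first by rewrite mul0r.
  rewrite IHe ?mulr0//; first exact: vanish_below_line.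
    by apply: ltn_trans kj _; apply: (w_lt Hhall); lia.
  by have := ls l; have := ls p; lia.
apply: (IHd m.+1) => //; first by lia.
move=> i; rewrite ltnS leq_eqVlt => /orP[/eqP im|im].
  have -> : i = k by exact: val_inj.
  by rewrite !mxE !eqxx mulr1 subrr.
exact: (vanish_below_line _ (leqnn k) xk).
Qed.

Lemma lder_adexp j p q x :
  lder (X j) (fun y => Q y p q) x = (A j * Q x) p q.
Proof.
by apply/eqP; rewrite -subr_eq0; apply/eqP; exact: (@adexp_defect_eq0 0).
Qed.

End AdjointEquation.

(** * Extremal polynomials as entries of E applied to the vector *)

Section ExtremalPolynomials.
Variables (R : realType) (r s n : nat) (hb : 'I_n -> option ('I_n * 'I_n)).
Variable w : 'I_n -> nat.
Hypothesis Hhall : hall_basis r s n hb w.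
Implicit Types (i j k l : 'I_n) (x : 'rV[R]_n) (al : {ffun 'I_n -> nat}).
Local Notation X := (HGG R hb).
Local Notation A := (admx R Hhall).
Let pX := polyvf_HGG R Hhall.

(** [admx j] records brackets with X_j on the left; bracketing on the right therefore multiplies
    coordinate rows by [- admx j]. *)
Lemma foldl_lie_HGG (t : seq 'I_n) (c : 'rV[R]_n) :
  foldl (fun Z j => lie Z (X j)) (fun x => \sum_k c ord0 k *: X k x) t =
  (fun x => \sum_k (c *m \prod_(j <- t) - A j) ord0 k *: X k x).
Proof.
elim: t c => [|j t IH] c /=; first by rewrite big_nil mulmx1.
rewrite big_cons [- A j * _]/(- A j *m _) mulmxA -IH; congr foldl.
rewrite -[LHS]/(lie _ _) (_ : lie _ _ = brk (fun x => \sum_k c ord0 k *: X k x) (X j)); last first.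
  by rewrite brk.unlock.
rewrite (brk_combl _ _ pX (pX j)); apply/funext => x.
have E k : brk (X k) (X j) x = \sum_l - A j k l *: X l x.
  by rewrite brkN (structure_constE _ Hhall) -sumrN; apply: eq_bigr => l _; rewrite mxE scaleNr.
under eq_bigr do rewrite E scaler_sumr.
rewrite exchange_big /=; apply: eq_bigr => l _.
under eq_bigr do rewrite scalerA.
rewrite -scaler_suml mxE; congr (_ *: _); apply: eq_bigr => k _.
by congr (_ * _); rewrite !mxE.
Qed.

Definition admx_pow al : 'M[R]_n := \prod_j A j ^+ al j.

Lemma prod_admxN al :
  \prod_(j <- flatten [seq nseq (al j) j | j <- enum 'I_n]) - A j =
  (-1) ^+ mabs al *: admx_pow al.
Proof.
have pow m j : \prod_(i <- nseq m j) - A i = (-1) ^+ m *: A j ^+ m.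
  elim: m => [|m IH]; first by rewrite big_nil !expr0 scale1r.
  by rewrite /= big_cons IH mulr_scalemx mulNr -exprS scalerN [(-1) ^+ m.+1]exprS mulN1r scaleNr.
have -> : enum 'I_n = index_enum 'I_n by rewrite [index_enum _]unlock enumT.
rewrite big_flatten big_map /admx_pow /mabs.
elim: (index_enum _) => [|j t IH]; first by rewrite !big_nil expr0 scale1r.
rewrite !big_cons /= pow IH mulr_scalemx exprD.
have -> (c : R) (B C : 'M[R]_n) : (c *: B) * C = c *: (B * C) by rewrite [RHS]scalemxAl.
by rewrite scalerA mulrC.
Qed.

Lemma itbrE i al :
  itbr R hb i al = fun x => \sum_k ((-1) ^+ mabs al *: admx_pow al) i k *: X k x.
Proof.
have -> : itbr R hb i al = foldl (fun Z j => lie Z (X j))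
    (fun x => \sum_k (delta_mx ord0 i : 'rV[R]_n) ord0 k *: X k x)
    (flatten [seq nseq (al j) j | j <- enum 'I_n]).
  congr foldl; apply/funext => x.
  rewrite (bigD1 i)//= mxE !eqxx scale1r big1 ?addr0// => k ki.
  by rewrite mxE (negbTE ki) andbF scale0r.
rewrite foldl_lie_HGG prod_admxN -rowE.
by apply/funext => x; apply: eq_bigr => k _; rewrite mxE.
Qed.

Lemma gscE i al : gsc R hb i al = \row_k ((-1) ^+ mabs al *: admx_pow al) i k.
Proof.
apply: xget_unique => [|c /=].
  by rewrite /= itbrE; apply/funext => x; apply: eq_bigr => k _; rewrite mxE.
rewrite itbrE => /(HGG_free Hhall) cE; apply/rowP => k.
by rewrite mxE (congr1 (@^~ k) cE).
Qed.

Lemma admx_pow_eq0 al j : (s < al j)%N -> admx_pow al = 0.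
Proof.
move=> sj; rewrite /admx_pow.
have : j \in index_enum 'I_n by rewrite mem_index_enum.
elim: (index_enum _) => // i t IH; rewrite inE big_cons.
case: eqVneq => [<- _|_ /= /IH ->]; last by rewrite mulr0.
by rewrite -(subnK sj) exprD admx_nilp mulr0 mul0r.
Qed.

Definition ffun_nat (f : {ffun 'I_n -> 'I_s.+1}) : {ffun 'I_n -> nat} :=
  [ffun j => f j : nat].

Lemma adexpE x : adexp Hhall x =
  \sum_(f : {ffun 'I_n -> 'I_s.+1})
    ((mfact (ffun_nat f))%:R^-1 * xpow x (ffun_nat f)) *: admx_pow (ffun_nat f).
Proof.
rewrite /adexp /expad bigA_distr_bigA; apply: eq_bigr => f _.
rewrite /mfact /xpow /admx_pow natr_prod -prodfV -big_split /=.
elim: (index_enum _) => [|j t IH]; first by rewrite !big_nil scale1r.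
rewrite !big_cons IH mulr_scalemx.
have -> (c : R) (B C : 'M[R]_n) : (c *: B) * C = c *: (B * C) by rewrite [RHS]scalemxAl.
by rewrite scalerA ffunE mulrC; congr ((_ * _) *: _); rewrite mulrC.
Qed.

(** The sign in the definition of P_i^v meets the same sign in the generalized structure constants,
    and their product is 1. Exponents above [s] contribute zero, so the sum over N^n equals the
    finite expansion of E. *)
Lemma PextE i (v : 'rV[R]_n) x :
  Pext R hb i v x = (adexp Hhall x *m v^T) i ord0.
Proof.
pose term (al : {ffun 'I_n -> nat}) : R :=
  (mfact al)%:R^-1 * xpow x al * (admx_pow al *m v^T) i ord0.
have termE al : (-1) ^+ mabs al / (mfact al)%:R *
      (\sum_(k < n) gsc R hb i al ord0 k * v ord0 k) * xpow x al = term al.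
  have -> : \sum_(k < n) gsc R hb i al ord0 k * v ord0 k =
      (-1) ^+ mabs al * (admx_pow al *m v^T) i ord0.
    rewrite gscE mxE big_distrr /=; apply: eq_bigr => k _.
    by rewrite !mxE mulrA.
  have := sqrr_sign R (mabs al); rewrite expr2 => sgn.
  have rearrange (e a b c : R) : e * a * (e * c) * b = e * e * (a * b * c) by ring.
  by apply: (etrans (rearrange _ _ _ _)); rewrite sgn mul1r.
have emb_inj : injective ffun_nat.
  move=> f g /ffunP fg; apply/ffunP => j; apply/val_inj.
  by have := fg j; rewrite !ffunE.
pose rng := [seq ffun_nat f | f <- index_enum {ffun 'I_n -> 'I_s.+1}].
have rng_uniq : uniq rng by rewrite map_inj_uniq// index_enum_uniq.
have -> : Pext R hb i v x = \sum_(al <- rng) term al.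
  rewrite (@bigfs _ _ _ _ rng predT term rng_uniq); last first.
    move=> al _ alr; rewrite /term.
    have [j sj] : exists j, (s < al j)%N.
      apply: contrapT => no; case/negP: alr; apply/mapP.
      exists [ffun j => inord (al j)]; first by rewrite mem_index_enum.
      apply/ffunP => j; rewrite !ffunE inordK// ltnS leqNgt.
      by apply/negP => sj; apply: no; exists j.
    by rewrite (admx_pow_eq0 sj) mul0mx mxE mulr0.
  rewrite /Pext (_ : [set` predT] = [set: {ffun 'I_n -> nat}]).
    by apply: eq_fsbigr => al _; exact: termE.
  by apply/seteqP; split.
rewrite big_map adexpE mulmx_suml summxE; apply: eq_bigr => f _.
by rewrite -scalemxAl [RHS]mxE.
Qed.

End ExtremalPolynomials.

(** * Lipschitz functions with almost everywhere zero derivative are constant *)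

Section LipschitzConstant.
Variable R : realType.
Implicit Types (f : R -> R) (s t c d e L : R).
Local Notation mu := (@lebesgue_measure R).

Lemma real_induction (P : R -> Prop) : P 0 ->
  (forall c, 0 <= c < 1 -> P c -> exists2 d, 0 < d & forall t, c < t < c + d -> t <= 1 -> P t) ->
  (forall c, 0 < c <= 1 -> (forall s, 0 <= s < c -> P s) -> P c) ->
  forall t, 0 <= t <= 1 -> P t.
Proof.
move=> P0 Pr Pl.
pose S : set R := [set t | 0 <= t <= 1 /\ forall s, 0 <= s <= t -> P s].
have S0 : S 0.
  by split=> [|s /andP[s0 s0']]; rewrite ?lexx ?ler01// (_ : s = 0)//;
    apply/eqP; rewrite eq_le s0 s0'.
have supS : has_sup S.
  by split; [exists 0|exists 1 => t [/andP[]]].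
have c0 : 0 <= sup S by apply: ub_le_sup => //; case: supS.
have c1 : sup S <= 1 by apply: ge_sup => [|t [/andP[]]]; first by exists 0.
have below s : 0 <= s < sup S -> P s.
  move=> /andP[s0 sc].
  have [t [_ Pt] st] := sup_gt (ex_intro _ 0 S0) sc.
  by apply: Pt; rewrite s0 ltW.
have Pc : P (sup S).
  have [->//|cn0] := eqVneq (sup S) 0.
  by apply: Pl => //; rewrite c1 lt_neqAle eq_sym cn0 c0.
have upto s : 0 <= s <= sup S -> P s.
  move=> /andP[s0]; rewrite le_eqVlt => /orP[/eqP->//|sc].
  by apply: below; rewrite s0 sc.
suff c1' : sup S = 1 by move=> t t01; apply: upto; rewrite c1'.
apply/eqP; rewrite eq_le c1 leNgt; apply/negP => clt1.
have [|d d0 Pd] := Pr (sup S) _ Pc; first by rewrite c0 clt1.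
pose t := Num.min (sup S + d / 2) 1.
have d2 : 0 < d / 2 by rewrite divr_gt0.
have ct : sup S < t by rewrite lt_min clt1 ltrDl d2.
have td : t < sup S + d.
  by rewrite gt_min ltrD2l ltr_pdivrMr// mulr_natr mulr2n ltrDl d0.
have t1 : t <= 1 by rewrite ge_min lexx orbT.
suff : t <= sup S by rewrite leNgt ct.
apply: ub_le_sup; first by case: supS.
split=> [|s /andP[s0 st]]; first by rewrite t1 andbT (le_trans c0 (ltW ct)).
have [sc|cs] := leP s (sup S); first by apply: upto; rewrite s0 sc.
by apply: Pd; [rewrite cs (le_lt_trans st td)|exact: le_trans st t1].
Qed.

(** The exceptional null set is covered by an open set U of measure at most [e], and [phi t] is the
    measure of U in [0, t]. Off the null set, f grows with slope at most [e]; on it, [phi] has slope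
    1 nearby, so [L * phi] absorbs the Lipschitz growth. Real induction glues these local bounds. *)
Lemma lipschitz_derive0_bound f L e : 0 <= L -> 0 < e ->
  (forall s t, I01 R s -> I01 R t -> `|f s - f t| <= L * `|s - t|) ->
  {ae mu, forall t, I01 R t -> is_derive t (1 : R) f 0} ->
  forall t, 0 <= t <= 1 -> `|f t - f 0| <= e + L * e.
Proof.
move=> L0 e0 lipf [N [mN N0 subN]].
have Nfin : (mu N < +oo)%E by rewrite N0 ltry.
have [U [oU NU UNe]] := lebesgue_regularity_outer mN Nfin e0.
have mU : measurable U by exact: open_measurable.
have Ue : (mu U <= e%:E)%E.
  have -> : U = (U `\` N) `|` N by rewrite setUC setDUK.
  rewrite measureU0//; [exact: ltW|exact: measurableD].
pose V t := U `&` `[0, t]%classic.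
have mV t : measurable (V t) by apply: measurableI => //; exact: measurable_itv.
have Vle t : (mu (V t) <= e%:E)%E.
  by apply: le_trans Ue; apply: le_measure; [exact: mem_set (mV _)|exact: mem_set|exact: subIsetl].
have Vfin t : mu (V t) \is a fin_num.
  by rewrite ge0_fin_numE//; apply: le_lt_trans (Vle t) _; rewrite ltry.
pose phi t := fine (mu (V t)).
have phi_le t : phi t <= e by rewrite -lee_fin fineK.
have phi_mono s t : s <= t -> phi s <= phi t.
  move=> st; rewrite -lee_fin !fineK//; apply: le_measure.
  - exact: mem_set (mV _).
  - exact: mem_set (mV _).
  apply: setIS => x /=; rewrite !in_itv/= => /andP[-> xs].
  exact: le_trans st.
have phi0 t : 0 <= phi t by rewrite fine_ge0.
have phi_incr c t : 0 <= c -> c < t -> `]c, t]%classic `<=` U ->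
    phi c + (t - c) <= phi t.
  move=> c0 ct ctU; rewrite -lee_fin EFinD fineK//.
  have -> : (t - c)%:E = mu `]c, t]%classic.
    by rewrite lebesgue_measure_itv/= lte_fin ct EFinB.
  rewrite /phi fineK// -measureU; [|exact: mV|exact: measurable_itv|]; last first.
  - apply/seteqP; split=> // x [[_ /=]]; rewrite !in_itv/= => /andP[_ xc].
    by rewrite ltNge xc.
  - apply: le_measure; [|exact: mem_set (mV _)|].
      by apply: mem_set; apply: measurableU; [exact: mV|exact: measurable_itv].
    move=> x [[Ux]|xct].
      rewrite /= !in_itv/= => /andP[x0 xc]; split=> //.
      by rewrite /= in_itv/= x0 (le_trans xc)// ltW.
    split; first exact: ctU.
    move: xct; rewrite /= !in_itv/= => /andP[cx ->]; rewrite andbT.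
    by rewrite (le_trans c0)// ltW.
suff key t : 0 <= t <= 1 -> `|f t - f 0| <= e * t + L * phi t.
  move=> t /[dup] /key ft /andP[t0 t1]; apply: le_trans ft _; apply: lerD.
    by rewrite ler_piMr// ltW.
  by rewrite ler_wpM2l.
move: t; apply: real_induction.
- by rewrite subrr normr0 mulr0 add0r mulr_ge0.
- move=> c /andP[c0 c1] Pc.
  have c01 : I01 R c by apply/andP; split=> //; exact: ltW.
  suff [d d0 fd] : exists2 d, 0 < d & forall t, c < t < c + d -> t <= 1 ->
      `|f t - f c| <= e * (t - c) + L * (phi t - phi c).
    exists d => // t ctd t1.
    rewrite -(subrK (f c) (f t)) -addrA (le_trans (ler_normD _ _))//.
    by have := fd t ctd t1; lra.
  have [cN|cN] := pselect (N c).
    have /nbhs_ballP[d /= d0 dU] : nbhs c U by apply: open_nbhs_nbhs; split=> //; exact: NU.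
    exists d => // t /andP[ct td] t1.
    have tE : `|t - c| = t - c by rewrite gtr0_norm// subr_gt0.
    have ft : `|f t - f c| <= L * (t - c).
      rewrite -tE; apply: lipf => //.
      by apply/andP; split=> //; exact: le_trans c0 (ltW ct).
    apply: (le_trans ft); rewrite -[leLHS]add0r lerD//.
      by rewrite mulr_ge0 ?subr_ge0 ?ltW.
    rewrite ler_wpM2l// lerBrDl; apply: phi_incr => // x /=; rewrite in_itv/= => /andP[cx xt].
    apply: dU; rewrite /ball/= distrC gtr0_norm ?subr_gt0// ltrBlDl.
    exact: le_lt_trans xt td.
  have [dfc fc0] : is_derive c (1 : R) f 0.
    by apply: contrapT => nd; apply/cN/subN => /(_ _)/nd; exact.
  move: dfc fc0; rewrite /derivable /derive => /[swap] /esym <- /cvgrPdist_le/(_ e e0).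
  rewrite near_withinE => /nbhs_ballP[d /= d0 fd].
  exists d => // t /andP[ct td] t1.
  have tc0 : 0 < t - c by rewrite subr_gt0.
  have := fd (t - c); rewrite /ball/= sub0r normrN gtr0_norm// ltrBlDl => /(_ td (lt0r_neq0 tc0)).
  rewrite sub0r normrN -[_%:A]/(_ * 1) mulr1 subrK -[_ *: _]/(_ * _) normrM normfV (gtr0_norm tc0).
  rewrite ler_pdivrMl// mulrC => fe; rewrite -[leLHS]addr0 lerD//.
  by rewrite mulr_ge0// subr_ge0 phi_mono// ltW.
- move=> c /andP[c0 c1] Ps.
  apply/ler_addgt0Pl => k k0.
  have L1 : 0 < L + 1 by rewrite ltr_wpDl.
  (* An earlier point close enough that f changes by at most the slack [k]; adding 1 to [L] keeps
     the quotient defined when [L] is 0. *)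
  pose s := Num.max 0 (c - k / (L + 1)).
  have s0 : 0 <= s by rewrite le_max lexx.
  have sc : s < c by rewrite gt_max c0 /= ltrBlDl ltrDr divr_gt0.
  have cs : c - s <= k / (L + 1) by rewrite lerBlDl -lerBlDr le_max lexx orbT.
  have fs : `|f c - f s| <= L * (c - s).
    rewrite -[c - s]gtr0_norm ?subr_gt0//; apply: lipf; apply/andP; split=> //.
      exact: ltW.
    exact: le_trans (ltW sc) c1.
  have Lk : L * (c - s) <= k.
    apply: (@le_trans _ _ ((L + 1) * (k / (L + 1)))); last by rewrite mulrCA mulfV ?mulr1// gt_eqF.
    by apply: ler_pM => //; [rewrite subr_ge0 ltW|rewrite lerDl].
  have := Ps s; rewrite s0 sc => /(_ isT) fs0.
  have phis : L * phi s <= L * phi c by rewrite ler_wpM2l// phi_mono// ltW.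
  have es : e * s <= e * c by rewrite ler_wpM2l// ltW.
  rewrite -(subrK (f s) (f c)) -addrA (le_trans (ler_normD _ _))//.
  by move: (phi s) (phi c) phis fs0 => p1 p2; lra.
Qed.

Lemma lipschitz_derive0_cst f L :
  (forall s t, I01 R s -> I01 R t -> `|f s - f t| <= L * `|s - t|) ->
  {ae mu, forall t, I01 R t -> is_derive t (1 : R) f 0} ->
  forall s t, I01 R s -> I01 R t -> f s = f t.
Proof.
move=> lipf df.
suff f0 t : I01 R t -> f t = f 0 by move=> s t /f0 -> /f0 ->.
move=> t01; apply/eqP; rewrite -subr_eq0 -normr_le0; apply/ler_addgt0Pl => k k0.
(* With e = k / (|L| + 1) the bound e + |L| e is exactly [k]; the absolute value is taken because
   [L] has no assumed sign. *)
have M1 : 0 < `|L| + 1 by rewrite ltr_wpDl.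
have k1 : 0 < k / (`|L| + 1) by rewrite divr_gt0.
have lipf' s' t' : I01 R s' -> I01 R t' -> `|f s' - f t'| <= `|L| * `|s' - t'|.
  move=> s01 t'01; apply: le_trans (lipf _ _ s01 t'01) _.
  by rewrite ler_wpM2r// ler_norm.
have := lipschitz_derive0_bound (normr_ge0 L) k1 lipf' df t01.
rewrite addr0; move/le_trans; apply.
by rewrite -[X in X + _]mul1r -mulrDl addrC mulrCA mulfV ?mulr1// gt_eqF.
Qed.

End LipschitzConstant.

(** * The frame of Hall fields and right-invariant forms *)

Section Frame.
Variables (R : realType) (r s n : nat) (hb : 'I_n -> option ('I_n * 'I_n)).
Variable w : 'I_n -> nat.
Hypothesis Hhall : hall_basis r s n hb w.
Implicit Types (i j k l p : 'I_n) (x : 'rV[R]_n) (v : 'rV[R]_n).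
Local Notation X := (HGG R hb).
Local Notation A := (admx R Hhall).
Local Notation Q := (adexp Hhall).
Let pX := polyvf_HGG R Hhall.
Let pQ : polymx Q := polymx_adexp R Hhall.

Definition hgg_frame x : 'M[R]_n := \matrix_(k, i) X k x ord0 i.

Definition hgg_jacobian j x : 'M[R]_n :=
  \matrix_(i, p) pd i (fun y => X j y ord0 p) x.

Lemma lder_frame j x :
  \matrix_(k, i) lder (X j) (fun y => X k y ord0 i) x =
  A j *m hgg_frame x + hgg_frame x *m hgg_jacobian j x.
Proof.
apply/matrixP => k i; rewrite !mxE; apply/eqP; rewrite -subr_eq; apply/eqP.
have := brk_HGG Hhall j k x i; rewrite brkE// => E.
transitivity (\sum_l A j k l * X l x ord0 i).
  by rewrite -E /lder; congr (_ - _); apply: eq_bigr => m _; rewrite !mxE.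
by apply: eq_bigr => l _; rewrite !mxE.
Qed.

(** The frame is unitriangular, so its adjugate is its inverse and has polynomial entries, as the
    calculus of [polyf] requires. *)
Lemma det_frame x : \det (hgg_frame x) = 1.
Proof.
rewrite -det_tr det_trig.
  by apply: big1 => i _; rewrite !mxE (HGG_low Hhall) ?eqxx.
by apply/is_trig_mxP => i j ij; rewrite !mxE (HGG_lt Hhall).
Qed.

Lemma adj_frame x : \adj (hgg_frame x) *m hgg_frame x = 1%:M.
Proof. by rewrite mul_adj_mx det_frame. Qed.

Lemma frame_adj x : hgg_frame x *m \adj (hgg_frame x) = 1%:M.
Proof. by rewrite mul_mx_adj det_frame. Qed.

Lemma frame_mul_tr x v j :
  (hgg_frame x *m v^T) j ord0 = \sum_i v ord0 i * X j x ord0 i.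
Proof. by rewrite mxE; apply: eq_bigr => i _; rewrite !mxE mulrC. Qed.

Lemma frame0 : hgg_frame 0 = 1%:M.
Proof.
apply/matrixP => k i; rewrite !mxE (HGG_vanish_below Hhall) ?mxE ?eqxx//= 1?eq_sym//.
by move=> j _; rewrite mxE.
Qed.

Lemma polymx_adj_frame : polymx (fun x => \adj (hgg_frame x)).
Proof.
move=> i k; under eq_fun do rewrite mxE /cofactor.
apply: polyf_mul; first exact: polyf_cst.
rewrite /determinant; apply: polyf_sum => sg; apply: polyf_mul; first exact: polyf_cst.
by apply: polyf_prod => l; under eq_fun do rewrite !mxE; exact: pX.
Qed.

Lemma lder_mul Y (f g : 'rV[R]_n -> R) x : polyf f -> polyf g ->
  lder Y (fun y => f y * g y) x = lder Y f x * g x + f x * lder Y g x.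
Proof.
move=> pf pg; rewrite /lder big_distrl big_distrr -big_split /=.
by apply: eq_bigr => k _; rewrite pd_mul// mulrDr mulrA mulrCA.
Qed.

Lemma lder_mulmx Y (F : 'rV[R]_n -> 'M[R]_n) (u : 'rV[R]_n -> 'cV[R]_n) x :
  polymx F -> (forall k, polyf (fun y => u y k ord0)) ->
  \col_k lder Y (fun y => (F y *m u y) k ord0) x =
  (\matrix_(k, i) lder Y (fun y => F y k i) x) *m u x +
  F x *m (\col_k lder Y (fun y => u y k ord0) x).
Proof.
move=> pF pu; apply/matrixP => k j; rewrite !mxE -big_split /=.
have -> : (fun y => (F y *m u y) k ord0) = (fun y => \sum_i F y k i * u y i ord0).
  by apply/funext => y; rewrite mxE.
transitivity (\sum_i lder Y (fun y => F y k i * u y i ord0) x).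
  rewrite /lder exchange_big /=; apply: eq_bigr => m _; rewrite pd_sum ?big_distrr//.
  by move=> i; exact: polyf_mul.
by apply: eq_bigr => i _; rewrite lder_mul// !mxE (ord1 j).
Qed.

(* The right-invariant 1-form whose value at the origin is v. *)
Definition invariant_form v x : 'cV[R]_n := \adj (hgg_frame x) *m (Q x *m v^T).

Lemma frame_invariant_form v x : hgg_frame x *m invariant_form v x = Q x *m v^T.
Proof. by rewrite mulmxA frame_adj mul1mx. Qed.

Lemma polyf_adexp_col v k : polyf (fun x => (Q x *m v^T) k ord0).
Proof.
under eq_fun do rewrite mxE.
by apply: polyf_sum => l; apply: polyf_mul; [exact: pQ|exact: polyf_cst].
Qed.

Lemma polyf_invariant_form v k : polyf (fun x => invariant_form v x k ord0).
Proof.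
under eq_fun do rewrite mxE.
apply: polyf_sum => l; apply: polyf_mul; first exact: polymx_adj_frame.
exact: polyf_adexp_col.
Qed.

Lemma lder_adexp_col j v x :
  \col_k lder (X j) (fun y => (Q y *m v^T) k ord0) x = A j *m (Q x *m v^T).
Proof.
rewrite (@lder_mulmx (X j) Q (fun=> v^T) x pQ); last by move=> k; exact: polyf_cst.
rewrite [X in _ + _ *m X](_ : _ = 0) ?mulmx0 ?addr0 ?mulmxA.
  congr (_ *m _); apply/matrixP => p q; rewrite mxE.
  exact: lder_adexp.
by apply/matrixP => k l; rewrite !mxE; apply: big1 => i _; rewrite pd_cst mulr0.
Qed.

(** Differentiating frame * form = E v along X_j gives (ad X_j) E v on both sides. After its
    cancellation and division by the frame, the adjoint equation is left. *)
Lemma lder_invariant_form j v x :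
  \col_k lder (X j) (fun y => invariant_form v y k ord0) x =
  - (hgg_jacobian j x *m invariant_form v x).
Proof.
have pM : polymx hgg_frame by move=> k i; under eq_fun do rewrite mxE; exact: pX.
have := lder_mulmx (X j) x pM (polyf_invariant_form v).
have -> : \col_k lder (X j) (fun y => (hgg_frame y *m invariant_form v y) k ord0) x =
    A j *m (Q x *m v^T).
  rewrite -lder_adexp_col; apply/matrixP => k l; rewrite !mxE.
  by congr lder; apply/funext => y; rewrite frame_invariant_form.
have -> : \matrix_(k, i) lder (X j) (fun y => hgg_frame y k i) x =
    A j *m hgg_frame x + hgg_frame x *m hgg_jacobian j x.
  rewrite -lder_frame; apply/matrixP => k i; rewrite !mxE.
  by congr lder; apply/funext => y; rewrite mxE.
rewrite mulmxDl -[A j *m _ *m _]mulmxA frame_invariant_form -addrA.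
move=> /esym/(canRL (addKr _)); rewrite addNr => /eqP; rewrite addr_eq0 => /eqP E.
rewrite -[LHS]mul1mx -(adj_frame x) -mulmxA -[hgg_frame x *m _]opprK -E.
by rewrite mulmxN -(mulmxA (hgg_frame x)) (mulmxA (\adj _)) adj_frame mul1mx.
Qed.

End Frame.

(** * Lipschitz functions on the unit interval and derivatives along curves *)

Section LipschitzFunctions.
Variables (R : realType) (n : nat).
Implicit Types (u v : R -> R) (t : R).

Definition lip01 u := exists L : R,
  forall s t, I01 R s -> I01 R t -> `|u s - u t| <= L * `|s - t|.

Lemma I01_0 : I01 R 0. Proof. by apply/andP. Qed.

Lemma lip01_cst (c : R) : lip01 (fun=> c).
Proof. by exists 0 => s t _ _; rewrite subrr normr0 mul0r. Qed.

Lemma lip01_add u v : lip01 u -> lip01 v -> lip01 (fun t => u t + v t).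
Proof.
move=> [L uL] [K vK]; exists (L + K) => s t s01 t01.
rewrite opprD addrACA (le_trans (ler_normD _ _))// mulrDl.
by apply: lerD; [exact: uL|exact: vK].
Qed.

Lemma lip01_opp u : lip01 u -> lip01 (fun t => - u t).
Proof.
by move=> [L uL]; exists L => s t s01 t01; rewrite -opprD normrN; exact: uL.
Qed.

Lemma lip01_bounded u : lip01 u -> exists M : R, 0 <= M /\ forall t, I01 R t -> `|u t| <= M.
Proof.
move=> [L uL]; exists (`|L| + `|u 0|); split=> [|t t01]; first exact: addr_ge0.
rewrite -[u t](subrK (u 0)) (le_trans (ler_normD _ _))// lerD2r.
apply: (le_trans (uL _ _ t01 I01_0)); rewrite subr0.
have /andP[t0 t1] := t01; rewrite (ger0_norm t0).
apply: (le_trans (ler_wpM2r t0 (ler_norm L))).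
by rewrite ler_piMr.
Qed.

Lemma lip01_mul u v : lip01 u -> lip01 v -> lip01 (fun t => u t * v t).
Proof.
move=> lu lv.
have [[M [M0 uM]] [N [N0 vN]]] := (lip01_bounded lu, lip01_bounded lv).
move: lu lv => [L uL] [K vK]; exists (M * K + L * N) => s t s01 t01.
have -> : u s * v s - u t * v t = u s * (v s - v t) + (u s - u t) * v t by ring.
rewrite (le_trans (ler_normD _ _))// !normrM mulrDl; apply: lerD.
  by rewrite -mulrA; apply: ler_pM => //; [exact: uM|exact: vK].
by rewrite -mulrA (mulrC N) mulrA; apply: ler_pM => //; [exact: uL|exact: vN].
Qed.

Lemma lip01_sum I (r : seq I) (P : pred I) (F : I -> R -> R) :
  (forall i, lip01 (F i)) -> lip01 (fun t => \sum_(i <- r | P i) F i t).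
Proof.
move=> lF; elim: r => [|i r IH]; first by under eq_fun do rewrite big_nil; exact: lip01_cst.
under eq_fun do rewrite big_cons.
by case: (P i) => //; exact: lip01_add.
Qed.

Lemma lipschitz01_coord (xi : R -> 'rV[R]_n) k :
  lipschitz01 xi -> lip01 (fun t => xi t ord0 k).
Proof.
move=> [L xiL]; exists L => s t s01 t01; apply: le_trans (xiL _ _ s01 t01).
rewrite [leRHS]/Num.Def.normr/= mx_normrE; apply: le_trans; last exact: (le_bigmax _ _ (ord0, k)).
by rewrite /= !mxE.
Qed.

Lemma lipschitz01_row (xi : R -> 'rV[R]_n) :
  (forall k, lip01 (fun t => xi t ord0 k)) -> lipschitz01 xi.
Proof.
move=> /(_ _)/cid lxi; pose L k := sval (lxi k).
exists (\sum_k `|L k|) => s t s01 t01.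
have L0 : 0 <= \sum_k `|L k| by apply: sumr_ge0.
rewrite [leLHS]/Num.Def.normr/= mx_normrE bigmax_le//= ?mulr_ge0// => -[i k] _ /=.
rewrite (ord1 i) !mxE; apply: (le_trans (svalP (lxi k) _ _ s01 t01)).
rewrite ler_wpM2r// -/(L k) (le_trans (ler_norm _))// (bigD1 k)//= lerDl.
exact: sumr_ge0.
Qed.

Lemma lip01_polyf f (g : R -> 'rV[R]_n) : lipschitz01 g -> polyf f ->
  lip01 (fun t => f (g t)).
Proof.
move=> lg; elim=> [c|i|{}f f' _ IHf _ IHf'|{}f f' _ IHf _ IHf'].
- exact: lip01_cst.
- exact: lipschitz01_coord.
- exact: lip01_add.
- exact: lip01_mul.
Qed.

Lemma is_derive1_coord (xi : R -> 'rV[R]_n) t k : derivable xi t 1 ->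
  is_derive t (1 : R) (fun s => xi s ord0 k) (derive1 xi t ord0 k).
Proof.
move=> d; split; first by move/derivable_mxP : d => /(_ ord0 k).
by rewrite derive1E derive_mx// mxE.
Qed.

Lemma is_derive1_mul u v t (a b : R) :
  is_derive t (1 : R) u a -> is_derive t (1 : R) v b ->
  is_derive t (1 : R) (fun s => u s * v s) (a * v t + u t * b).
Proof.
move=> du dv; apply: (is_derive_eq (is_deriveM du dv)).
by rewrite -[u t *: b]/(u t * b) -[v t *: a]/(v t * a) addrC mulrC.
Qed.

Lemma is_derive1_sum I (r : seq I) (F : I -> R -> R) (a : I -> R) t :
  (forall i, is_derive t (1 : R) (F i) (a i)) ->
  is_derive t (1 : R) (fun s => \sum_(i <- r) F i s) (\sum_(i <- r) a i).
Proof.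
move=> dF; elim: r => [|i r IH].
  by under eq_fun do rewrite big_nil; rewrite big_nil; exact: is_derive_cst.
by under eq_fun do rewrite big_cons; rewrite big_cons; exact: is_deriveD.
Qed.

Lemma is_derive1_polyf f (g : R -> 'rV[R]_n) t : polyf f -> derivable g t 1 ->
  is_derive t (1 : R) (fun s => f (g s)) (\sum_k derive1 g t ord0 k * pd k f (g t)).
Proof.
move=> pf /[dup] dg /derivable1_diffP dg'.
have df := polyf_differentiable (g t) pf.
have dfg : differentiable (f \o g) t by exact: differentiable_comp.
split; first exact/derivable1_diffP.
rewrite -[(fun s => f (g s))]/(f \o g) deriveE// diff_comp//=.
by rewrite -derive_pd// deriveE// derive1E'.
Qed.

End LipschitzFunctions.

(** * Combining almost-everywhere statements *)

Section AlmostEverywhere.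
Variable R : realType.
Local Notation mu := (@lebesgue_measure R).

Lemma ae_sub (P P' : R -> Prop) : (forall t, P t -> P' t) ->
  {ae mu, forall t, P t} -> {ae mu, forall t, P' t}.
Proof. exact: (@filterS _ _ (ae_filter_ringOfSetsType mu)). Qed.

Lemma ae_and (P P' : R -> Prop) : {ae mu, forall t, P t} -> {ae mu, forall t, P' t} ->
  {ae mu, forall t, P t /\ P' t}.
Proof. exact: (@filterI _ _ (ae_filter_ringOfSetsType mu)). Qed.

End AlmostEverywhere.

(** * The linear system along a horizontal curve, and dual curves *)

Section HorizontalCurves.
Variables (R : realType) (r s n : nat) (hb : 'I_n -> option ('I_n * 'I_n)).
Variable w : 'I_n -> nat.
Hypothesis Hhall : hall_basis r s n hb w.
Variables (g : R -> 'rV[R]_n) (h : 'I_n -> R -> R).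
Hypothesis Hhor : horizontal r hb g h.
Hypothesis Hg0 : g 0 = 0.
Implicit Types (i j k l p : 'I_n) (v : 'rV[R]_n) (t : R).
Local Notation X := (HGG R hb).
Local Notation A := (admx R Hhall).
Local Notation Q := (adexp Hhall).
Local Notation mu := (@lebesgue_measure R).
Let pX := polyvf_HGG R Hhall.

Lemma horizontal_lipschitz : lipschitz01 g. Proof. by case: Hhor. Qed.

(** The quantifier over [f] stands inside, so that one null set serves all polynomials at once. *)
Lemma horizontal_derive : {ae mu, forall t, I01 R t -> forall f, polyf f ->
  is_derive t (1 : R) (fun s => f (g s))
    (\sum_(j < n | (j < r)%N) h j t * lder (X j) f (g t))}.
Proof.
case: Hhor => _ _; apply: ae_sub => t + t01 f pf => /(_ t01)[dg gE].
apply: (is_derive_eq (is_derive1_polyf pf dg)); rewrite gE.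
under eq_bigr do rewrite summxE big_distrl /=.
rewrite exchange_big /=; apply: eq_bigr => j _; rewrite /lder big_distrr /=.
by apply: eq_bigr => k _; rewrite mxE mulrA.
Qed.

(** The base time is arbitrary: 0 serves to compare two solutions, while a later time, followed back
    to 0, shows that dual curves never vanish. *)
Lemma adjoint_unique (u : R -> 'cV[R]_n) (t0 : R) :
  (forall k, lip01 (fun t => u t k ord0)) ->
  {ae mu, forall t, I01 R t -> forall k,
    is_derive t (1 : R) (fun s => u s k ord0)
      (\sum_(j < n | (j < r)%N) h j t * (A j *m u t) k ord0)} ->
  I01 R t0 -> u t0 = 0 -> forall t, I01 R t -> u t = 0.
Proof.
move=> lu du t001 ut0 t t01; apply/matrixP => k z; rewrite (ord1 z) [RHS]mxE {z}.
(* Each A j strictly raises the weight, so the system is triangular. *)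
have [d] := ubnP (s - w k)%N; elim: d k t t01 => // d IH k t t01 kd.
have [L uL] := lu k.
rewrite (@lipschitz_derive0_cst _ (fun t => u t k ord0) L uL _ t t0)//.
  by rewrite ut0 mxE.
move: du; apply: ae_sub => t' du' t'01; have := du' t'01 k; congr is_derive.
apply: big1 => j _; rewrite mxE big1 ?mulr0// => l _.
have [->|/admx_neq0 wl] := eqVneq (A j k l) 0; first by rewrite mul0r.
rewrite IH ?mulr0//.
by have := w_gt0 Hhall j; have := w_les Hhall l; lia.
Qed.

Lemma derive_adexp_col : {ae mu, forall t, I01 R t -> forall v k,
  is_derive t (1 : R) (fun s => (Q (g s) *m v^T) k ord0)
    (\sum_(j < n | (j < r)%N) h j t * (A j *m (Q (g t) *m v^T)) k ord0)}.
Proof.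
apply: ae_sub horizontal_derive => t + t01 v k => /(_ t01 _ (polyf_adexp_col Hhall v k)).
move=> d; apply: (is_derive_eq d); apply: eq_bigr => j _.
by rewrite -lder_adexp_col [in RHS]mxE.
Qed.

Lemma lip01_adexp_col v k : lip01 (fun t => (Q (g t) *m v^T) k ord0).
Proof. exact: lip01_polyf horizontal_lipschitz (polyf_adexp_col Hhall v k). Qed.

Lemma dual_curve_adexp (xi : R -> 'rV[R]_n) : dual_curve r hb g h xi ->
  forall t, I01 R t -> hgg_frame hb (g t) *m (xi t)^T = Q (g t) *m (xi 0)^T.
Proof.
move=> [lxi _ dxi _].
pose u t := hgg_frame hb (g t) *m (xi t)^T - Q (g t) *m (xi 0)^T.
have uE t k : u t k ord0 = \sum_i X k (g t) ord0 i * xi t ord0 i -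
    (Q (g t) *m (xi 0)^T) k ord0.
  rewrite [LHS]mxE; congr (_ + _); last by rewrite [LHS]mxE.
  by rewrite frame_mul_tr; apply: eq_bigr => i _; rewrite mulrC.
suff u0 t : I01 R t -> u t = 0 by move=> t /u0/subr0_eq.
apply: (@adjoint_unique u 0).
- move=> k; under eq_fun do rewrite uE.
  apply: lip01_add; last exact/lip01_opp/lip01_adexp_col.
  apply: lip01_sum => i; apply: lip01_mul; last exact: lipschitz01_coord.
  exact: lip01_polyf horizontal_lipschitz (pX k i).
- apply: ae_sub (ae_and horizontal_derive (ae_and derive_adexp_col dxi)).
  move=> t' [+ [+ +]] t'01 k => /(_ t'01) dg /(_ t'01 (xi 0) k) dQ /(_ t'01)[dxit xiE].
  have dxik i := is_derive1_coord i dxit.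
  have dX i := is_derive1_mul (dg _ (pX k i)) (dxik i).
  have := is_deriveB (is_derive1_sum (index_enum _) dX) dQ.
  move=> du; rewrite (_ : (fun s => u s k ord0) = (fun s => \sum_i X k (g s) ord0 i * xi s ord0 i) -
    (fun s => (Q (g s) *m (xi 0)^T) k ord0)); last by apply/funext => s'; rewrite uE.
  apply: (is_derive_eq du).
  (* Differentiating the fields yields an adjoint term and a Jacobian term; the adjoint equation for
     [xi] cancels exactly the latter. *)
  have EJ : forall j, \sum_i lder (X j) (fun x => X k x ord0 i) (g t') * xi t' ord0 i =
      (A j *m (hgg_frame hb (g t') *m (xi t')^T)) k ord0 +
      (hgg_frame hb (g t') *m (hgg_jacobian hb j (g t') *m (xi t')^T)) k ord0.
    move=> j; transitivity (((\matrix_(k, i) lder (X j) (fun y => X k y ord0 i) (g t')) *m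
        (xi t')^T) k ord0).
      by rewrite mxE; apply: eq_bigr => i _; rewrite !mxE.
    by rewrite (lder_frame Hhall) mulmxDl !mulmxA [LHS]mxE.
  have xiE' i : derive1 xi t' ord0 i =
      - \sum_(j < n | (j < r)%N) h j t' * (hgg_jacobian hb j (g t') *m (xi t')^T) i ord0.
    rewrite xiE; congr (- _); apply: eq_bigr => j _; rewrite mxE big_distrr /=.
    by apply: eq_bigr => p _; rewrite !mxE derive_delta// -mulrA mulrCA.
  rewrite big_split /=.
  under eq_bigr do rewrite big_distrl /=.
  rewrite exchange_big /=.
  under eq_bigr => j _.
    under eq_bigr do rewrite -mulrA.
    rewrite -big_distrr /= EJ mulrDr; over.
  rewrite big_split /=.
  have -> : \sum_i X k (g t') ord0 i * derive1 xi t' ord0 i =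
      - \sum_(j < n | (j < r)%N) h j t' *
        (hgg_frame hb (g t') *m (hgg_jacobian hb j (g t') *m (xi t')^T)) k ord0.
    under eq_bigr do rewrite xiE' mulrN big_distrr /=.
    rewrite sumrN exchange_big /=; congr (- _); apply: eq_bigr => j _.
    rewrite [in RHS]mxE big_distrr /=; apply: eq_bigr => i _.
    by rewrite [hgg_frame _ _ _ _]mxE mulrCA.
  rewrite addrK -sumrB; apply: eq_bigr => j _; rewrite -mulrBr; congr (_ * _).
  by rewrite /u mulmxBr [RHS]mxE; congr (_ + _); rewrite [RHS]mxE.
- exact: I01_0.
- by rewrite /u Hg0 (frame0 R Hhall) adexp0 subrr.
Qed.

Definition dual_of v t : 'rV[R]_n := (invariant_form Hhall v (g t))^T.

Lemma dual_of0 v : dual_of v 0 = v.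
Proof.
rewrite /dual_of Hg0 -[invariant_form _ _ _]mul1mx -(frame0 R Hhall).
by rewrite frame_invariant_form adexp0 mul1mx trmxK.
Qed.

Lemma frame_dual_of v t : hgg_frame hb (g t) *m (dual_of v t)^T = Q (g t) *m v^T.
Proof. by rewrite trmxK frame_invariant_form. Qed.

(** E v solves the linear system along the curve, so its vanishing at [t0] propagates back to time
    0, where E is the identity. *)
Lemma adexp_col_eq0 v t0 : I01 R t0 -> Q (g t0) *m v^T = 0 -> v = 0.
Proof.
move=> t001 Qv0.
have dQ : {ae mu, forall t, I01 R t -> forall k,
    is_derive t (1 : R) (fun s => (Q (g s) *m v^T) k ord0)
      (\sum_(j < n | (j < r)%N) h j t * (A j *m (Q (g t) *m v^T)) k ord0)}.
  by apply: ae_sub derive_adexp_col => t d t01 k; exact: d.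
have := adjoint_unique (lip01_adexp_col v) dQ t001 Qv0 (I01_0 R).
by rewrite Hg0 adexp0 mul1mx => /(congr1 trmx); rewrite trmxK trmx0.
Qed.

Lemma dual_curve_dual_of v : v != 0 ->
  (forall t, I01 R t -> Zvar r hb v (g t)) -> dual_curve r hb g h (dual_of v).
Proof.
move=> v0 gZ.
have dE t k : dual_of v t ord0 k = invariant_form Hhall v (g t) k ord0 by rewrite mxE.
split.
- apply: lipschitz01_row => k; under eq_fun do rewrite dE.
  exact: lip01_polyf horizontal_lipschitz (polyf_invariant_form Hhall v k).
- move=> t t01; apply: contra_neq v0 => xi0; apply: (adexp_col_eq0 t01).
  by rewrite -frame_dual_of xi0 trmx0 mulmx0.
- apply: ae_sub horizontal_derive => t + t01 => /(_ t01) dg.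
  have d k : is_derive t (1 : R) (fun s => dual_of v s ord0 k)
      (\sum_(j < n | (j < r)%N) h j t *
        lder (X j) (fun y => invariant_form Hhall v y k ord0) (g t)).
    by under eq_fun do rewrite dE; exact: dg (polyf_invariant_form Hhall v k).
  have dxi : derivable (dual_of v) t 1.
    by apply/derivable_mxP => i k; rewrite (ord1 i); case: (d k).
  split=> // k; rewrite derive1E derive_mx// mxE; case: (d k) => _ ->.
  rewrite -sumrN; apply: eq_bigr => j _.
  have -> : lder (X j) (fun y => invariant_form Hhall v y k ord0) (g t) =
      (\col_k lder (X j) (fun y => invariant_form Hhall v y k ord0) (g t)) k ord0.
    by rewrite [RHS]mxE.
  rewrite lder_invariant_form [X in _ * X]mxE mulrN; congr (- _).
  rewrite mxE big_distrr /=; apply: eq_bigr => p _.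
  by rewrite dE mxE derive_delta// mulrCA mulrA.
- move=> t t01 j jr.
  transitivity ((hgg_frame hb (g t) *m (dual_of v t)^T) j ord0).
    by rewrite frame_mul_tr.
  rewrite frame_dual_of -PextE; exact: gZ.
Qed.

Lemma dual_curve_Zvar (xi : R -> 'rV[R]_n) t : dual_curve r hb g h xi ->
  I01 R t -> Zvar r hb (xi 0) (g t).
Proof.
move=> dxi t01 j jr; rewrite (PextE Hhall) -(dual_curve_adexp dxi t01).
case: dxi => _ _ _ /(_ t t01 j jr) <-.
exact: frame_mul_tr.
Qed.

End HorizontalCurves.

Theorem theorem4p9 (R : realType) (r s n : nat)
    (hb : 'I_n -> option ('I_n * 'I_n)) (w : 'I_n -> nat)
    (Hr : (2 <= r)%N) (Hs : (2 <= s)%N) (Hhall : hall_basis r s n hb w)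
    (g : R -> 'rV[R]_n) (h : 'I_n -> R -> R)
    (Hhor : horizontal r hb g h) (Hg0 : g 0 = 0)
    (m : nat) (Hm : (1 <= m)%N) :
  abnormal_corank r hb g h m <->
  exists vs : 'I_m -> 'rV[R]_n,
    (forall lam : 'I_m -> R, \sum_(l < m) lam l *: vs l = 0 -> forall l, lam l = 0) /\
    (forall t, I01 R t -> forall l, Zvar r hb (vs l) (g t)).
Proof.
split=> [[xis [dxi free]]|[vs [free gZ]]].
- exists (fun l => xis l 0); split=> [lam lam0|t t01 l]; last first.
    exact: (dual_curve_Zvar Hhall Hhor Hg0 (dxi l)).
  (* By [dual_curve_adexp], xi(t) is a fixed linear image of xi(0), so a relation between initial
     values holds at all times. *)
  apply: free => t t01; apply: trmx_inj.
  rewrite -[LHS]mul1mx -(adj_frame Hhall (g t)) -mulmxA linear_sum /= mulmx_sumr.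
  under eq_bigr => l _.
    rewrite linearZ /= -scalemxAr (dual_curve_adexp Hhall Hhor Hg0 (dxi l) t01).
    rewrite scalemxAr -linearZ /=; over.
  by rewrite -mulmx_sumr -linear_sum lam0 linear0 trmx0 !mulmx0.
- exists (fun l => dual_of Hhall g (vs l)); split=> [l|lam lam0].
    apply: (dual_curve_dual_of Hhall Hhor Hg0); last by move=> t t01; exact: gZ.
    (* Dual curves require v nonzero: a zero vector in the family would give the relation with
       coefficient 1 at [l] and 0 elsewhere. *)
    apply/eqP => vl0; have := free (fun l' => (l' == l)%:R).
    rewrite (bigD1 l)//= vl0 scaler0 add0r big1 => [/(_ erefl l)/eqP|l' /negbTE ->].
      by rewrite eqxx oner_eq0.
    by rewrite scale0r.
  apply: free; rewrite -[RHS](lam0 0 (I01_0 R)); apply: eq_bigr => l _.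
  by rewrite dual_of0.
Qed.
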